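(* Let $\xi=\{\xi(t),t\in\mathbb{R}\}$ be a real-valued, measurable, mean-square continuous stationary Gaussian process with $E\xi(t)=0$, $E\xi^2(t)=1$ and covariance function $$B(t)=E[\xi(0)\xi(t)]=\sum_{j=0}^{\kappa}D_j\frac{\cos(\varkappa_j t)}{(1+t^2)^{\alpha_j/2}},\quad t\in\mathbb{R},$$ where $\kappa\ge 0$ is an integer, $D_j\ge 0$, $\sum_{j=0}^{\kappa}D_j=1$, $0\le\varkappa_0<\varkappa_1<\dots<\varkappa_\kappa$ and $\alpha_j>0$ for all $j$. Let $G:\mathbb{R}\to\mathbb{R}$ be a non-random measurable function with $E\,G(\xi(0))=0$, $E\,G^4(\xi(0))<\infty$ and Hermite rank $m\ge 1$, and let $\varepsilon(t)=G(\xi(t))$. Consider the regression model $x(t)=g(t,\theta)+\varepsilon(t)$, $t\in[0,T]$, where $\Theta\subset\mathbb{R}^q$ is open with closure $\Theta^c$, $\theta\in\Theta$ is the true parameter and $g:\mathbb{R}\times\Theta^c\to\mathbb{R}$ is continuous. Assume (with the notation $g_i,g_{il},d_{iT},d_{il,T},h,h_i,h_{il},V^c(R)$ given in the context): (1) $g(t,\tau)$ is twice differentiable with respect to $\tau\in\Theta^c$; (2) $\liminf_{T\to\infty}T^{-1}d_{iT}^2(\theta)>0$ for $i=1,\dots,q$; (3) for every $R\ge 0$ there are positive constants $k^i(R),k^{il}(R),\tilde k^{il}(R)$ such that for all sufficiently large $T>T_0(R)$ and all $i,l=1,\dots,q$, $$\sup_{t\in[0,T]}\sup_{u\in V^c(R)}\frac{|h_i(t,u)|}{d_{iT}(\theta)}\le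 k^i(R)T^{-1/2},\quad \sup_{t\in[0,T]}\sup_{u\in V^c(R)}\frac{|h_{il}(t,u)|}{d_{il,T}(\theta)}\le k^{il}(R)T^{-1/2},\quad \frac{d_{il,T}(\theta)}{d_{iT}(\theta)d_{lT}(\theta)}\le\tilde k^{il}(R)T^{-1/2}.$$ Then for any $R>0$ and $r>0$, $$P\left\{\sup_{u\in V^c(R)}\left\|\psi_T(u)-L_T(u)\right\|>r\right\}\longrightarrow 0,\qquad T\to\infty,$$ where $\psi_T(u)=(\psi_T^i(u))_{i=1}^q$ and $L_T(u)=(L_T^i(u))_{i=1}^q$ are given by $$\psi_T^i(u)=\int_0^T\varepsilon(t)\frac{h_i(t,u)}{d_{iT}(\theta)}dt+\int_0^T\bigl(h(t,0)-h(t,u)\bigr)\frac{h_i(t,u)}{d_{iT}(\theta)}dt,$$ $$L_T^i(u)=\int_0^T\left(\varepsilon(t)-\sum_{l=1}^q\frac{g_l(t,\theta)}{d_{lT}(\theta)}u_l\right)\frac{g_i(t,\theta)}{d_{iT}(\theta)}dt .$$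
   Context: Notation. $g_i(t,\tau)=\partial g(t,\tau)/\partial\tau_i$, $g_{il}(t,\tau)=\partial^2g(t,\tau)/\partial\tau_i\partial\tau_l$; $d_{iT}^2(\tau)=\int_0^Tg_i^2(t,\tau)dt$, $d_T(\tau)=\mathrm{diag}(d_{iT}(\tau))_{i=1}^q$, $d_{il,T}^2(\tau)=\int_0^Tg_{il}^2(t,\tau)dt$ (all $d$'s non-negative). $h(t,u)=g(t,\theta+d_T^{-1}(\theta)u)$, $h_i(t,u)=g_i(t,\theta+d_T^{-1}(\theta)u)$, $h_{il}(t,u)=g_{il}(t,\theta+d_T^{-1}(\theta)u)$. $V^c(R)=\{u\in\mathbb{R}^q:\|u\|\le R\}$. For $T>T_0(R)$ one has $\theta+d_T^{-1}(\theta)u\in\Theta$ for all $u\in V^c(R)$. An inequality of the form $|a|/d\le c$ with $d\ge0$ is understood as $|a|\le c\,d$. Hermite rank: with $\varphi(x)=(2\pi)^{-1/2}e^{-x^2/2}$ and Hermite polynomials $H_k(x)=(-1)^ke^{x^2/2}\frac{d^k}{dx^k}e^{-x^2/2}$, put $C_k=\int_{\mathbb{R}}G(x)H_k(x)\varphi(x)dx$. The Hermite rank of $G$ is $m$ if $C_m\ne0$ and $C_k=0$ for $1\le k<m$. *)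

(* Defs.v *)
From HB Require Import structures.
From mathcomp Require Import all_boot all_order all_algebra.
From mathcomp Require Import all_classical all_reals all_analysis.

Set Implicit Arguments.
Unset Strict Implicit.
Unset Printing Implicit Defensive.

Import Order.TTheory GRing.Theory Num.Theory.
Import numFieldNormedType.Exports.

Local Open Scope classical_set_scope.
Local Open Scope ring_scope.

Section processes.
Context d (Omega : measurableType d) (R : realType) (P : probability Omega R).
Implicit Types xi : R -> Omega -> R.

Definition measurable_process xi :=
  measurable_fun [set: R * Omega] (fun p : R * Omega => xi p.1 p.2).

(* The Dirac case covers degenerate Gaussian laws: [normal_prob m 0] is the
   uniform law on [0, 1], not the point mass at m. *)
Definition gaussian_rv (X : Omega -> R) :=
  exists m s : R, forall A : set R, measurable A ->
    P (X @^-1` A) = if s == 0 then \d_m A else normal_prob m s A.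

Definition gaussian_process xi :=
  forall n (t a : 'I_n -> R),
    gaussian_rv (fun w => \sum_(i < n) a i * xi (t i) w).

Definition fidi xi n (t : 'I_n -> R) (w : Omega) : n.-tuple R :=
  [tuple xi (t i) w | i < n].

Definition stationary xi :=
  forall n (t : 'I_n -> R) (s : R) (A : set (n.-tuple R)), measurable A ->
    P (fidi xi (fun i => t i + s) @^-1` A) = P (fidi xi t @^-1` A).

Definition ms_continuous xi :=
  forall t : R, 'E_P[fun w => ((xi s w - xi t w) ^+ 2)%R]%E @[s --> t] --> 0%E.

End processes.

Section hermite.
Context (R : realType).

Definition hermite (k : nat) (x : R) : R :=
  (-1) ^+ k * expR (x ^+ 2 / 2) * derive1n k (fun y => expR (- (y ^+ 2 / 2))) x.

Definition hermite_coef (G : R -> R) (k : nat) : \bar R :=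
  (\int[lebesgue_measure]_x (G x * hermite k x * normal_pdf 0 1 x)%:E)%E.

Definition hermite_rank (G : R -> R) (m : nat) :=
  hermite_coef G m <> 0%E /\
  forall k : nat, (1 <= k < m)%N -> hermite_coef G k = 0%E.

End hermite.

Section calculus.
Context (R : realType) (q : nat).
Implicit Types (f : 'rV[R]_q -> R) (D : set 'rV[R]_q) (x u : 'rV[R]_q).

(* The norm that 'rV[R]_q carries in the library is the sup norm; it induces
   the same topology. *)
Definition enorm u : R := Num.sqrt (\sum_(i < q) u 0 i ^+ 2).

Definition eball (r : R) : set 'rV[R]_q := [set u | enorm u <= r].

(* Frechet derivative of f along D, so that points of D which are not interior
   are meaningful even though f is only relevant on D. *)
Definition has_gradient_within D f x (v : 'I_q -> R) :=
  forall e : R, 0 < e -> \forall y \near within D (nbhs x),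
    `|f y - f x - \sum_(i < q) v i * (y 0 i - x 0 i)| <= e * enorm (y - x).

Definition twice_differentiable_on D f :=
  exists (v : 'I_q -> 'rV[R]_q -> R) (w : 'I_q -> 'I_q -> 'rV[R]_q -> R),
    forall x, D x ->
      has_gradient_within D f x (v ^~ x) /\
      forall i, has_gradient_within D (v i) x ((w i) ^~ x).

(* This is the partial derivative at interior points of the domain of f only;
   elsewhere it depends on how f has been extended. *)
Definition partial (i : 'I_q) f x : R := 'D_(delta_mx 0 i) f x.

End calculus.

Section regression.
Context (R : realType) (q : nat) (g : R -> 'rV[R]_q -> R).
Context (theta : 'rV[R]_q).
Implicit Types (i l : 'I_q) (T t : R) (u : 'rV[R]_q).

Definition g1 i t (tau : 'rV[R]_q) : R := partial i (g t) tau.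

Definition g2 i l t (tau : 'rV[R]_q) : R := partial l (g1 i t) tau.

(* Real-valued integrals: a divergent one counts as 0. *)
Definition d1 T i : R :=
  Num.sqrt (\int[lebesgue_measure]_(t in `[0, T]) (g1 i t theta ^+ 2)).

Definition d2 T i l : R :=
  Num.sqrt (\int[lebesgue_measure]_(t in `[0, T]) (g2 i l t theta ^+ 2)).

(* theta + d_T(theta)^-1 u *)
Definition local_param T u : 'rV[R]_q := \row_i (theta 0 i + u 0 i / d1 T i).

Definition h T t u : R := g t (local_param T u).
Definition h1 T i t u : R := g1 i t (local_param T u).
Definition h2 T i l t u : R := g2 i l t (local_param T u).

(* eps is one path of the noise. *)
Definition psi (eps : R -> R) T u : 'rV[R]_q :=
  \row_i (\int[lebesgue_measure]_(t in `[0, T]) (eps t * (h1 T i t u / d1 T i))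
        + \int[lebesgue_measure]_(t in `[0, T])
            ((h T t 0 - h T t u) * (h1 T i t u / d1 T i))).

Definition Lin (eps : R -> R) T u : 'rV[R]_q :=
  \row_i \int[lebesgue_measure]_(t in `[0, T])
     ((eps t - \sum_(l < q) g1 l t theta / d1 T l * u 0 l)
      * (g1 i t theta / d1 T i)).

End regression.

(* Main.v *)
Require Import Defs.
From HB Require Import structures.
From mathcomp Require Import all_boot all_order all_algebra.
From mathcomp Require Import all_classical all_reals all_analysis.
From mathcomp Require Import measurable_realfun ring lra.

(** On a ball of local parameters u the difference psi - Lin has a random part,
    the integral of the noise against the increment of the normalized score
    h1 / d1 between 0 and u, and a deterministic part.

    The hypotheses say that h1 / d1 is O(T^(-1/2)), and by the mean value theorem
    that its increments are O(|u - v| / T) (near_nscore_bounds). The deterministic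
    part is then an integral over [0, T] of a function of order T^(-3/2), hence it
    vanishes. For the random part the size 1 / T of the increments is not enough:
    it only gives a bounded quantity. But it gives equicontinuity in u, which
    reduces the supremum to finitely many parameters (box_net, psi_Lin_le); at a
    fixed parameter one needs a law of large numbers: averages of the noise
    against weights bounded by 1 / T on [0, T] tend to 0 in mean.

    This law of large numbers is gaussian_ergodic. An observable f is called
    ergodic if the centered averages of f (xi t) tend to 0 in mean, uniformly over
    the weights. By a second moment computation f is ergodic as soon as the
    covariance of f (xi s) and f (xi t) decays (ergodic_of_decay). For f a cosine this covariance involves only the
    laws of xi s + xi t and xi s - xi t, which are Gaussian; it is an explicit
    function of the covariance of the process, which tends to 0 at infinity
    (gaussian_cos, ergodic_cos). Ergodicity then spreads from cosines to all
    integrable functions: to polynomials in a cosine, to indicators of half-lines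
    as limits of such polynomials, to indicators of Borel sets by a Dynkin class
    argument, and to L1 by density, since the mean size of an average is bounded
    by the L1 norm of the observable (ergodic_approx, ergodic_half_line,
    ergodic_integrable). As G is in L1 and has mean zero, the conclusion follows
    from Markov's inequality (markov_outer).

    The majorants in outer_mean_le are measurable functions that may be infinite;
    they absorb the non-measurability of the supremum and the negligible set of
    paths along which the noise is not integrable. *)

Set Implicit Arguments.
Unset Strict Implicit.
Unset Printing Implicit Defensive.

Import Order.TTheory GRing.Theory Num.Theory.
Import numFieldNormedType.Exports.

Local Open Scope classical_set_scope.
Local Open Scope ring_scope.

(** * Normal laws and Stein's identity *)

Section normal_law.
Context {R : realType}.
Notation mu := (@lebesgue_measure R).

(** The fundamental theorem of calculus on the whole line: truncate to
    [-n, n], where the integral is F n - F (- n), and let n grow by dominated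
    convergence. *)
Lemma integral_line_eq0 (F f : R -> R) :
  continuous f -> (forall x : R, is_derive x 1 F (f x)) ->
  mu.-integrable setT (EFin \o f) ->
  F x @[x --> +oo] --> (0 : R) -> F x @[x --> -oo] --> (0 : R) ->
  (\int[mu]_x (f x)%:E = 0)%E.
Proof.
move=> cf dF intf Fy FNy.
pose I n : set R := `[- n.+1%:R, n.+1%:R]%classic.
pose fn n : R -> \bar R := (EFin \o f) \_ (I n).
have mf : measurable_fun [set: R] (fun x => (f x)%:E) by exact: measurable_int intf.
have mfn n : measurable_fun setT (fn n).
  by apply/(measurable_restrictT _ _).1; [exact: measurable_itv|exact: measurable_funTS].
have fnf : {ae mu, forall x, [set: R] x -> fn n x @[n --> \oo] --> (f x)%:E}.
  apply: aeW => x _; apply: cvg_near_cst.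
  near=> n; rewrite /fn patchE mem_set// /I/= in_itv/= -ler_norml.
  near: n.
  exists (Num.truncn `|x|).+1 => // n /= xn; rewrite (le_trans (ltW (truncnS_gt _)))// ler_nat.
  exact: (leq_trans xn).
have fnb : {ae mu, forall x n, [set: R] x -> (`|fn n x| <= `|(f x)%:E|)%E}.
  apply: aeW => x n _; rewrite /fn patchE; case: ifPn => //= _.
  by rewrite normr0 lee_fin.
have [_ _ cvf] := @dominated_convergence _ _ _ mu _ measurableT _ _ _ mfn mf fnf (integrable_abse intf) fnb.
have intfn n : (\int[mu]_x fn n x = (F n.+1%:R - F (- n.+1%:R))%:E)%E.
  rewrite -integral_mkcond EFinB; apply: continuous_FTC2.
  - by rewrite ltrNl (lt_le_trans _ (ler0n _ _))// oppr_lt0.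
  - exact: continuous_subspaceT.
  - have dF' x : derivable F x 1 by [].
    split => //.
    + apply: cvg_at_right_filter; apply: differentiable_continuous.
      exact/derivable1_diffP.
    + apply: cvg_at_left_filter; apply: differentiable_continuous.
      exact/derivable1_diffP.
  - by move=> x _; rewrite derive1E derive_val.
suff c0 : (\int[mu]_x fn n x)%E @[n --> \oo] --> 0%E.
  by rewrite -(cvg_lim _ c0)//; apply/esym/cvg_lim; [|exact: cvf].
under eq_fun do rewrite intfn.
apply: cvg_EFin; first by exact: nearW.
rewrite -[X in _ --> X](subrr (0 : R)).
have cn : (n.+1%:R : R) @[n --> \oo] --> +oo.
  apply/cvgryPge => A; exists (Num.truncn `|A|).+1 => // n /= An.
  by rewrite (le_trans (ler_norm _))// (le_trans (ltW (truncnS_gt _)))// ler_nat leqW.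
apply: cvgB.
  by apply: (cvg_comp _ _ cn Fy).
apply: (@cvg_comp _ _ _ (fun n => - n.+1%:R : R) F); last exact: FNy.
by apply/cvgNrNy.
Unshelve. all: by end_near. Qed.

(** The Radon-Nikodym derivative of the normal law is its density almost
    everywhere, because both have the same integral on every measurable set;
    the two conclusions are then the change of variables, applied to f and to
    its absolute value. *)
Lemma normal_integral (m s : R) (f : R -> \bar R) :
  (normal_prob m s).-integrable setT f ->
  mu.-integrable setT (fun x => f x * (normal_pdf m s x)%:E)%E /\
  (\int[mu]_x (f x * (normal_pdf m s x)%:E) = \int[normal_prob m s]_x f x)%E.
Proof.
move=> intf; have dom := @normal_prob_dominates R m s.
pose N := [the probability _ _ of normal_prob m s].
have domN : charge_of_finite_measure N `<< mu := dom.
pose rn := Radon_Nikodym (charge_of_finite_measure N) mu.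
have mf : measurable_fun setT f := measurable_int _ intf.
have mpdf : measurable_fun [set: R] (fun x => (normal_pdf m s x)%:E).
  by apply/measurable_EFinP; exact: measurable_normal_pdf.
have rnE : ae_eq mu setT rn (fun x => (normal_pdf m s x)%:E).
  apply: (@integral_ae_eq _ _ _ mu _ measurableT _ rn) => //.
    exact: (Radon_Nikodym_integrable domN).
  by move=> A _ mA; rewrite -(Radon_Nikodym_integral domN).
have change (h : R -> \bar R) : N.-integrable setT h ->
    (\int[mu]_x (h x * (normal_pdf m s x)%:E) = \int[N]_x h x)%E.
  move=> ih; have mh : measurable_fun setT h := measurable_int _ ih.
  rewrite -(@Radon_Nikodym_change_of_variables _ _ _ N mu dom)//.
  apply: ae_eq_integral => //.
  - exact: emeasurable_funM.
  - by apply: emeasurable_funM => //; exact: measurable_int (Radon_Nikodym_integrable domN).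
  - by apply: ae_eqe_mul2l; exact: ae_eq_sym.
split; last exact: change.
apply/integrableP; split; first by apply: emeasurable_funM.
have pE x : (`|f x * (normal_pdf m s x)%:E| = `|f x| * (normal_pdf m s x)%:E)%E.
  by rewrite abseM [X in (_ * X)%E]gee0_abs// lee_fin normal_pdf_ge0.
under eq_integral do rewrite pE.
rewrite change; last exact: integrable_abse.
by case/integrableP : intf.
Qed.

Lemma is_derive_normal_pdf (m s x : R) : s != 0 ->
  is_derive x 1 (normal_pdf m s) (- ((x - m) / s ^+ 2) * normal_pdf m s x).
Proof.
move=> s0; rewrite normal_pdfE// /normal_fun.
apply: is_derive_eq.
rewrite /GRing.scale/= -mulr_natr; field.
by rewrite s0.
Qed.

(** Since 1 + y <= expR y, the density is O(1/x^2), which beats linear growth: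
    this gives the boundary terms of the integration by parts below. *)
Lemma normal_pdf_decay (m s K : R) (f : R -> R) : s != 0 -> 0 <= K ->
  (forall x, `|f x| <= K * (1 + `|x|)) ->
  exists C : R, forall x, 1 <= `|x| -> 2 * `|m| <= `|x| ->
    `|f x * normal_pdf m s x| <= C / `|x|.
Proof.
move=> s0 K0 fK; pose p := normal_peak s.
have p0 : 0 <= p by exact: normal_peak_ge0.
have s2 : 0 < s ^+ 2 by rewrite exprn_even_gt0.
exists (16 * K * p * s ^+ 2) => x x1 xm.
have x0 : 0 < `|x| by exact: lt_le_trans x1.
have x2 : 0 < `|x| ^+ 2 by exact: exprn_gt0.
have xm2 : `|x| / 2 <= `|x - m| by have := lerB_dist x m; lra.
have xm3 : (`|x| / 2) ^+ 2 <= (x - m) ^+ 2.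
  by rewrite -(real_normK (num_real (x - m))) lerXn2r// ?nnegrE// divr_ge0.
have pdfE : normal_pdf m s x <= p * (8 * s ^+ 2 / `|x| ^+ 2).
  rewrite normal_pdfE// ler_wpM2l// /normal_fun mulNr expRN.
  rewrite -[leRHS]invrK lef_pV2 ?posrE ?expR_gt0 ?invr_gt0//; last first.
    by apply: divr_gt0 => //; exact: mulr_gt0.
  have -> : (8 * s ^+ 2 / `|x| ^+ 2)^-1 = (`|x| / 2) ^+ 2 / (s ^+ 2 *+ 2).
    by rewrite -mulr_natr; field; rewrite s0 gt_eqF.
  rewrite (le_trans _ (expR_ge1Dx _))// ler_wpDl// ler_wpM2r//.
  by rewrite invr_ge0 mulrn_wge0// ltW.
rewrite normrM (ger0_norm (normal_pdf_ge0 _ _ _)).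
apply: (le_trans (ler_pM _ _ (fK x) pdfE)) => //; first exact: normal_pdf_ge0.
have -> : 16 * K * p * s ^+ 2 / `|x| = K * (2 * `|x|) * (p * (8 * s ^+ 2 / `|x| ^+ 2)).
  by field; rewrite gt_eqF.
rewrite ler_wpM2r//.
  by rewrite mulr_ge0// divr_ge0 ?(ltW x2)// mulr_ge0// ltW.
by rewrite ler_wpM2l//; lra.
Qed.


(** Stein's identity. The density p satisfies p' = - (x - m) / s^2 p, so
    (f p)' = (df - (x - m) f / s^2) p, and f p vanishes at infinity. *)
Lemma normal_stein (m s K : R) (f df : R -> R) : s != 0 -> 0 <= K ->
  (forall x, `|f x| <= K * (1 + `|x|)) ->
  (forall x : R, is_derive x 1 f (df x)) -> continuous df ->
  (normal_prob m s).-integrable setT (EFin \o df) ->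
  (normal_prob m s).-integrable setT (fun x => ((x - m) * f x)%:E) ->
  \int[normal_prob m s]_x ((x - m) * f x) = s ^+ 2 * \int[normal_prob m s]_x df x.
Proof.
move=> s0 K0 fK fdf cdf idf ixf.
have s2 : 0 < s ^+ 2 by rewrite exprn_even_gt0.
pose h x := df x - (s ^+ 2)^-1 * ((x - m) * f x).
have cf : continuous f.
  by move=> x; apply: differentiable_continuous; apply/derivable1_diffP.
have ixf' : (normal_prob m s).-integrable setT (fun x => ((s ^+ 2)^-1 * ((x - m) * f x))%:E).
  by under eq_fun do rewrite EFinM; exact: integrableZl.
have ih : (normal_prob m s).-integrable setT (EFin \o h).
  by rewrite /comp /h; under eq_fun do rewrite EFinB; exact: integrableB.
have [ihp hE] := normal_integral ih.
have : (\int[mu]_x (h x * normal_pdf m s x)%:E = 0)%E.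
  apply: (@integral_line_eq0 (fun x => f x * normal_pdf m s x)).
  - move=> x; apply: cvgM; last exact: continuous_normal_pdf.
    apply: cvgB; first exact: cdf.
    apply: cvgM; first exact: cvg_cst.
    apply: cvgM; last exact: cf.
    by apply: cvgB; [exact: cvg_id|exact: cvg_cst].
  - move=> x; have := is_derive_normal_pdf m x s0 => dp; have dfx := fdf x.
    apply: is_derive_eq; rewrite /GRing.scale/= /h; field; exact: s0.
  - exact: ihp.
  - have [C HC] := normal_pdf_decay m s0 K0 fK.
    apply/cvgr0Pnorm_le => e e0; near=> x.
    have x0 : 0 < x by near: x; exact: nbhs_pinfty_gt.
    apply: (le_trans (HC x _ _)); rewrite (gtr0_norm x0).
    + by near: x; apply: nbhs_pinfty_ge; exact: num_real.
    + by near: x; apply: nbhs_pinfty_ge; exact: num_real.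
    + rewrite ler_pdivrMr// -ler_pdivrMl//; near: x; apply: nbhs_pinfty_ge; exact: num_real.
  - have [C HC] := normal_pdf_decay m s0 K0 fK.
    apply/cvgr0Pnorm_le => e e0; near=> x.
    have x0 : x < 0 by near: x; exact: nbhs_ninfty_lt.
    apply: (le_trans (HC x _ _)); rewrite (ltr0_norm x0).
    + by rewrite lerNr; near: x; apply: nbhs_ninfty_le; exact: num_real.
    + by rewrite lerNr; near: x; apply: nbhs_ninfty_le; exact: num_real.
    + rewrite ler_pdivrMr ?oppr_gt0// -ler_pdivrMl// lerNr; near: x; apply: nbhs_ninfty_le; exact: num_real.
rewrite [X in X = _ -> _]hE => h0.
have : \int[normal_prob m s]_x h x = 0 by rewrite /Rintegral h0.
rewrite RintegralB// RintegralZl// => /eqP; rewrite subr_eq0 => /eqP ->.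
by rewrite mulVKf// gt_eqF.
Unshelve. all: by end_near. Qed.

End normal_law.

Lemma integrable_of_bounded d (T : measurableType d) (R : realType)
    (m : {finite_measure set T -> \bar R}) (f : T -> R) (M : R) :
  measurable_fun setT f -> (forall x, `|f x| <= M) ->
  m.-integrable setT (EFin \o f).
Proof.
move=> mf fM; apply: measurable_bounded_integrable => //.
  by rewrite ltey_eq fin_num_measure.
exists M; split; first exact: num_real.
by move=> y My x _ /=; rewrite (le_trans (fM x))// ltW.
Qed.

Lemma integrable_of_sq d (T : measurableType d) (R : realType)
    (m : {finite_measure set T -> \bar R}) (X : T -> R) :
  measurable_fun setT X -> m.-integrable setT (fun w => (X w ^+ 2)%:E) ->
  m.-integrable setT (fun w => (X w)%:E).
Proof.
move=> mX iX2.
have i1 : m.-integrable setT (fun w => (1 + X w ^+ 2)%:E).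
  under eq_fun do rewrite EFinD; apply: integrableD => //.
  by apply: (@integrable_of_bounded _ _ _ m (cst 1) 1) => // w; rewrite normr1.
apply: (le_integrable measurableT _ _ i1) => [|w _].
  by apply/measurable_EFinP.
rewrite /= lee_fin [leRHS]ger0_norm ?addr_ge0 ?sqr_ge0//.
have := sqr_ge0 (`|X w| - 1); rewrite sqrrB1 real_normK ?num_real// => h.
by have := normr_ge0 (X w); lra.
Qed.

Section affine_trigonometry.
Context {R : realType}.

Let affine_continuous (a b : R) : continuous (fun x : R => a * x + b).
Proof.
move=> x; apply: cvgD; last exact: cvg_cst.
by apply: cvgM; [exact: cvg_cst|exact: cvg_id].
Qed.

Lemma cos_affine_continuous (a b : R) : continuous (fun x : R => cos (a * x + b)).
Proof.
by move=> x; apply: continuous_comp; [exact: affine_continuous|exact: continuous_cos].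
Qed.

Lemma sin_affine_continuous (a b : R) : continuous (fun x : R => sin (a * x + b)).
Proof.
by move=> x; apply: continuous_comp; [exact: affine_continuous|exact: continuous_sin].
Qed.

End affine_trigonometry.

Section normal_moments.
Context {R : realType} (m s : R) (s0 : s != 0).
Let N := [the probability _ _ of normal_prob m s].
Hypothesis sq_int : N.-integrable setT (fun x : R => (x ^+ 2)%:E).

Let N1 : fine (normal_prob m s setT) = 1.
Proof. by have /= -> := @probability_setT _ _ _ N. Qed.

Let id_int : N.-integrable setT (fun x : R => x%:E).
Proof. exact: (@integrable_of_sq _ _ _ N id (@measurable_id _ _ _) sq_int). Qed.

Lemma normal_mean : \int[N]_x x = m.
Proof.
have xm : N.-integrable setT (fun x : R => ((x - m) * 1)%:E).
  under eq_fun do rewrite mulr1 EFinB; apply: integrableB => //.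
  exact: finite_measure_integrable_cst.
have := @normal_stein R m s 1 (cst 1) (cst 0) s0 ler01.
rewrite [X in _ -> _ -> _ -> _ -> _ -> _ = _ * X]Rintegral_cst// mul0r mulr0.
under [X in _ -> _ -> _ -> _ -> _ -> X = _]eq_Rintegral do rewrite mulr1.
rewrite RintegralB//=; last exact: finite_measure_integrable_cst.
rewrite [X in _ - X]Rintegral_cst// N1 mulr1 => h.
apply/eqP; rewrite -subr_eq0; apply/eqP/h => //.
- by move=> x /=; rewrite normr1 mul1r lerDl.
- by move=> x; exact: cst_continuous.
- exact: finite_measure_integrable_cst.
Qed.

Hypothesis m0 : m = 0.

Lemma normal_variance : \int[N]_x (x ^+ 2) = s ^+ 2.
Proof.
have st : \int[normal_prob m s]_x ((x - m) * id x) =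
    s ^+ 2 * \int[normal_prob m s]_x cst 1 x.
  apply: (@normal_stein R m s 1) => //.
  - by move=> x /=; rewrite mul1r lerDr.
  - by move=> x; exact: cst_continuous.
  - by apply: (@integrable_of_bounded _ _ _ N _ 1) => // x /=; rewrite normr1.
  - by under eq_fun do rewrite [X in _ - X]m0 subr0 -expr2.
rewrite Rintegral_cst// N1 mul1r mulr1 in st.
by rewrite -st; apply: eq_Rintegral => x _; rewrite m0 subr0 expr2.
Qed.

Let cos_int (a b : R) : N.-integrable setT (fun x : R => (cos (a * x + b))%:E).
Proof.
apply: (@integrable_of_bounded _ _ _ _ _ 1) => [|x].
  by apply: continuous_measurable_fun; exact: cos_affine_continuous.
by rewrite ler_norml cos_geN1 cos_le1.
Qed.

(** The characteristic function of the centered normal law, with a phase b.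
    Differentiating under the integral sign and applying Stein's identity to
    sin (a x + b) gives c' a = - a s^2 c a; hence c a * expR (a^2 s^2 / 2) is
    constant. *)
Lemma normal_cos (a b : R) :
  \int[N]_x cos (a * x + b) = expR (- (a ^+ 2 * s ^+ 2 / 2)) * cos b.
Proof.
pose c a := \int[N]_x cos (a * x + b).
have xsin_int (a' : R) : N.-integrable setT (fun x : R => (x * sin (a' * x + b))%:E).
  apply: (@integrableMl _ _ _ N setT measurableT (fun x => x%:E) (fun x => sin (a' * x + b))) => //.
    by apply: continuous_measurable_fun; exact: sin_affine_continuous.
  exists 1; split; first exact: num_real.
  move=> y y1 x _ /=; rewrite (le_trans _ (ltW y1))// ler_norml.
  by rewrite sin_geN1 sin_le1.
have dcos (x a' : R) : is_derive a' 1 (fun t : R => cos (t * x + b)) (- x * sin (a' * x + b)).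
  by apply: is_derive_eq; rewrite /GRing.scale/=; ring.
have dc (a' : R) : is_derive a' 1 c (- (s ^+ 2 * a' * c a')).
  have aI : `](a' - 1), (a' + 1)[%classic a'.
    by rewrite /= in_itv/= ltrBlDr ltrDl ltr01.
  have hint (x : R) : `](a' - 1), (a' + 1)[%classic x ->
      N.-integrable setT (EFin \o (fun y : R => cos (x * y + b))).
    by move=> _; exact: cos_int.
  have hder (x y : R) : `](a' - 1), (a' + 1)[%classic x -> [set: R] y ->
      derivable (fun t : R => cos (t * y + b)) x 1.
    by move=> _ _; have := dcos y x => ?; exact: ex_derive.
  have hub (x y : R) : `](a' - 1), (a' + 1)[%classic x -> [set: R] y ->
      `|partial1of2 (fun t (y : R) => cos (t * y + b)) x y| <= `|y|.
    move=> _ _; rewrite partial1of2E; have := dcos y x => ?.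
    rewrite derive_val normrM normrN ler_piMr//.
    by rewrite ler_norml sin_geN1 sin_le1.
  have hG : N.-integrable setT (EFin \o (fun y : R => `|y|)).
    exact: integrable_norm.
  have der := @derivable_under_integral R _ _ N _ _ measurableT _ _ _ aI hint hder
    _ (fun y => normr_ge0 y) hG hub.
  apply: DeriveDef => //.
  rewrite -derive1E (@differentiation_under_integral R _ _ N _ _ measurableT _ _ _ aI hint hder
    _ (fun y => normr_ge0 y) hG hub).
  transitivity (- \int[N]_y (y * sin (a' * y + b))).
    rewrite -mulN1r -(RintegralZl _ measurableT (xsin_int a')); apply: eq_Rintegral => y _.
    rewrite partial1of2E; have := dcos y a' => ?.
    by rewrite derive_val mulN1r mulNr.
  have st : \int[N]_y ((y - m) * sin (a' * y + b)) =
      s ^+ 2 * \int[N]_y (a' * cos (a' * y + b)).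
    apply: (@normal_stein R m s 1 (fun y => sin (a' * y + b))) => //.
    - move=> x; rewrite mul1r (@le_trans _ _ 1)// ?lerDl//.
      by rewrite ler_norml sin_geN1 sin_le1.
    - by move=> x; apply: is_derive_eq; rewrite /GRing.scale/=; ring.
    - by move=> x; apply: cvgM; [exact: cvg_cst|exact: cos_affine_continuous].
    - by rewrite /comp; under eq_fun do rewrite EFinM; exact: integrableZl.
    - by under eq_fun do rewrite [X in _ - X]m0 subr0; exact: xsin_int.
  rewrite (RintegralZl _ measurableT (cos_int a' b)) mulrA in st.
  by congr (- _); rewrite -st; apply: eq_Rintegral => y _; rewrite m0 subr0.
pose h t := c t * expR (t ^+ 2 * s ^+ 2 / 2).
have dh (t : R) : is_derive t 1 h 0.
  by have := dc t => ?; apply: is_derive_eq; rewrite /GRing.scale/=; field.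
have := is_derive_0_is_cst a 0 dh; rewrite /h expr0n/= !mul0r expR0 mulr1.
have -> : c 0 = cos b.
  rewrite /c; under eq_Rintegral do rewrite mul0r add0r.
  by rewrite Rintegral_cst// N1 mulr1.
by rewrite -/(c a) => <-; rewrite expRN mulrC mulfK// gt_eqF// expR_gt0.
Qed.

End normal_moments.

(** The law of a Gaussian variable enters only through this formula. The mean and
    the second moment identify the two parameters, which the hypothesis leaves
    unspecified; the degenerate case is a Dirac mass at 0. *)
Lemma gaussian_cos (R : realType) d (Omega : measurableType d)
    (P : probability Omega R) (W : Omega -> R) (v a b : R) :
  measurable_fun setT W -> gaussian_rv P W ->
  P.-integrable setT (fun w => (W w ^+ 2)%:E) ->
  \int[P]_w W w = 0 -> \int[P]_w (W w ^+ 2) = v ->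
  \int[P]_w cos (a * W w + b) = expR (- (a ^+ 2 * v / 2)) * cos b.
Proof.
move=> mW [m [s law]] iW2 EW EW2.
have cos_mf : measurable_fun [set: R] (fun x : R => cos (a * x + b)).
  by apply: continuous_measurable_fun; exact: cos_affine_continuous.
have iW := integrable_of_sq mW iW2.
have transfer (Q : {measure set (measurableTypeR R) -> \bar R}) (f : R -> R) :
    (forall A, measurable A -> P (W @^-1` A) = Q A) ->
    measurable_fun [set: R] f -> P.-integrable setT (fun w => (f (W w))%:E) ->
    Q.-integrable setT (EFin \o f) /\ \int[P]_w f (W w) = \int[Q]_x f x.
  move=> PQ mf iPf.
  have mEf : measurable_fun [set: R] (EFin \o f) by apply/measurable_EFinP.
  have mW' : measurable_fun setT (W : Omega -> measurableTypeR R) := mW.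
  pose X : {mfun Omega >-> measurableTypeR R} :=
    HB.pack (W : Omega -> measurableTypeR R) (isMeasurableFun.Build _ _ _ _ _ mW').
  pose PW := [the probability _ _ of distribution P X].
  have eqm (h : R -> \bar R) : (\int[PW]_x h x = \int[Q]_x h x)%E.
    by apply: eq_measure_integral => A mA _; exact: PQ.
  split.
    apply/integrableP; split => //; rewrite -eqm (ge0_integral_distribution X)//.
      by case/integrableP : iPf.
    exact: measurableT_comp.
  by rewrite /Rintegral -eqm (integral_distribution (X := X)).
have [s0|s0] := eqVneq s 0; last first.
  pose N := [the probability _ _ of normal_prob m s].
  have PN A : measurable A -> P (W @^-1` A) = N A.
    by move=> mA; rewrite law// (negbTE s0).
  have [iN2 E2] := transfer N (fun x => x ^+ 2) PN (measurable_funX _ (@measurable_id _ _ _)) iW2.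
  have [_ E1] := transfer N id PN (@measurable_id _ _ _) iW.
  have m0 : m = 0 by rewrite -(normal_mean s0 iN2) -[LHS]E1.
  have [|_ ->] := transfer N (fun x => cos (a * x + b)) PN cos_mf.
    apply: (@integrable_of_bounded _ _ _ _ _ 1) => [|w].
      exact: measurableT_comp cos_mf mW.
    by rewrite ler_norml cos_geN1 cos_le1.
  by rewrite (normal_cos s0 iN2 m0) -(normal_variance s0 iN2 m0) -EW2 E2.
have PN A : measurable A -> P (W @^-1` A) = \d_m A.
  by move=> mA; rewrite law// s0 eqxx.
have dirac (f : R -> R) : measurable_fun [set: R] f ->
    P.-integrable setT (fun w => (f (W w))%:E) -> \int[P]_w f (W w) = f m.
  move=> mf iPf; have [_ ->] := transfer [the measure _ _ of \d_(m : measurableTypeR R)] f PN mf iPf.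
  rewrite /Rintegral integral_dirac//; last by apply/measurable_EFinP.
  by rewrite diracE mem_set// mul1e.
have m0 : m = 0 by rewrite -EW -[LHS](dirac id).
rewrite (dirac (fun x => cos (a * x + b)))//; last first.
  apply: (@integrable_of_bounded _ _ _ _ _ 1) => [|w].
    exact: measurableT_comp cos_mf mW.
  by rewrite ler_norml cos_geN1 cos_le1.
have v0 : v = 0 by rewrite -EW2 (dirac (fun x => x ^+ 2)) ?m0 ?expr0n.
by rewrite m0 v0 !mulr0 mul0r oppr0 expR0 mul1r add0r.
Qed.

(** * Outer means *)

Section outer_mean.
Context d (Omega : measurableType d) (R : realType) (P : probability Omega R).

(** An upper bound for the outer mean of |Z|. Suprema over an uncountable set of
    parameters need not be measurable, and the integral along a path is only
    meaningful when that path is integrable: a measurable majorant Y, allowed to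
    be infinite, deals with both, since an inequality at a point where Y is +oo
    is for free. *)
Definition outer_mean_le (Z : Omega -> R) (e : R) :=
  exists Y : Omega -> \bar R, [/\ measurable_fun setT Y,
    forall w, (`|Z w|%:E <= Y w)%E & (\int[P]_w Y w <= e%:E)%E].

Lemma outer_mean_leD (Z1 Z2 Z : Omega -> R) (e1 e2 : R) :
  outer_mean_le Z1 e1 -> outer_mean_le Z2 e2 ->
  (forall w, `|Z w| <= `|Z1 w| + `|Z2 w|) ->
  outer_mean_le Z (e1 + e2).
Proof.
move=> [Y1 [mY1 ZY1 E1]] [Y2 [mY2 ZY2 E2]] Z12.
have Y1_ge0 w : (0 <= Y1 w)%E by apply: le_trans (ZY1 w); rewrite lee_fin.
have Y2_ge0 w : (0 <= Y2 w)%E by apply: le_trans (ZY2 w); rewrite lee_fin.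
exists (fun w => Y1 w + Y2 w)%E; split; first exact: emeasurable_funD.
  move=> w; rewrite (@le_trans _ _ (`|Z1 w|%:E + `|Z2 w|%:E)%E)//.
    by rewrite -EFinD lee_fin.
  exact: leeD.
by rewrite ge0_integralD// EFinD leeD.
Qed.

Lemma outer_mean_leZ (Z1 Z : Omega -> R) (c e : R) : 0 <= c ->
  outer_mean_le Z1 e -> (forall w, `|Z w| <= c * `|Z1 w|) ->
  outer_mean_le Z (c * e).
Proof.
move=> c0 [Y1 [mY1 ZY1 E1]] ZZ1.
have Y1_ge0 w : (0 <= Y1 w)%E by apply: le_trans (ZY1 w); rewrite lee_fin.
exists (fun w => c%:E * Y1 w)%E; split; first exact: measurable_funeM.
  move=> w; rewrite (@le_trans _ _ (c%:E * `|Z1 w|%:E)%E)//.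
    by rewrite -EFinM lee_fin.
  by apply: lee_pmul.
by rewrite ge0_integralZl// EFinM; apply: lee_pmul; rewrite ?lee_fin ?integral_ge0.
Qed.

Lemma outer_mean_le_le (Z1 Z : Omega -> R) (e1 e : R) :
  outer_mean_le Z1 e1 -> (forall w, `|Z w| <= `|Z1 w|) -> e1 <= e ->
  outer_mean_le Z e.
Proof.
move=> [Y1 [mY1 ZY1 E1]] ZZ1 e1e; exists Y1; split => //.
  by move=> w; rewrite (le_trans _ (ZY1 w))// lee_fin.
by rewrite (le_trans E1)// lee_fin.
Qed.

Lemma outer_mean_le_cst (e : R) : 0 <= e -> outer_mean_le (cst e) e.
Proof.
move=> e0; exists (cst e%:E); split => // [w|].
  by rewrite /= ger0_norm.
by rewrite integral_cst//= probability_setT mule1.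
Qed.

Lemma outer_mean_le_sum (I : eqType) (s : seq I) (Z : I -> Omega -> R) (e : R) :
  (forall i, i \in s -> outer_mean_le (Z i) e) ->
  outer_mean_le (fun w => \sum_(i <- s) `|Z i w|) ((size s)%:R * e).
Proof.
elim: s => [|i s IH] Ze /=.
  rewrite mul0r; apply: (outer_mean_le_le (outer_mean_le_cst (lexx 0))) => // w.
  by rewrite big_nil.
have {}IH := IH (fun j js => Ze j (mem_behead (s := i :: s) js)).
rewrite -natr1 mulrDl mul1r addrC; apply: (outer_mean_leD (Ze i (mem_head i s)) IH) => w.
by rewrite big_cons (le_trans (ler_normD _ _))// normr_id.
Qed.

(** Markov's inequality for the majorant Y1, whose upper level set is measurable
    and contains A. *)
Lemma markov_outer (A : set Omega) (Y : Omega -> R) (e r : R) : 0 < r ->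
  outer_mean_le Y e -> A `<=` [set w | r <= `|Y w|] ->
  (mu_ext P A <= (r^-1 * e)%:E)%E.
Proof.
move=> r0 [Y1 [mY1 ZY1 E1]] AY.
have Y1_ge0 w : (0 <= Y1 w)%E by apply: le_trans (ZY1 w); rewrite lee_fin.
pose B := [set w | (r%:E <= `|Y1 w|)%E].
have mB : measurable B.
  by rewrite -[B]setTI; apply: emeasurable_fun_c_infty => //; exact: measurableT_comp.
have AB : A `<=` B.
  by move=> w /AY /= rY; rewrite /B /= gee0_abs// (le_trans _ (ZY1 w))// lee_fin.
apply: le_trans (le_mu_ext P AB) _.
rewrite measurable_mu_extE// EFinM lee_pdivlMl// (le_trans _ E1)//.
have := @le_integral_comp_abse _ _ _ P setT measurableT Y1 r id.
rewrite setTI; under eq_integral do rewrite gee0_abs//; exact.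
Qed.

End outer_mean.

(** * Weighted time averages *)

(** The weights against which the noise is averaged: the variation of the
    normalized score between two parameters has this form, up to a constant. *)
Definition weight {R : realType} (T : R) (phi : R -> R) :=
  measurable_fun [set: R] phi /\ forall t, `|phi t| <= T^-1 * \1_(`[0, T]%classic) t.

Section weights.
Context {R : realType}.
Notation lam := (@lebesgue_measure R).

Let itv_int (a b c : R) : a <= b -> 0 <= c ->
  (\int[lam]_t (c * \1_(`[a, b]%classic) t)%:E = (c * (b - a))%:E)%E.
Proof.
move=> ab c0; under eq_integral do rewrite EFinM.
rewrite ge0_integralZl//=; last first.
  by apply/measurable_EFinP; exact: measurable_indic.
rewrite integral_indic//= setIT lebesgue_measure_itv/= lte_fin -EFinD.
case: ltP => [_ //|ba]; have -> : b - a = 0 by lra.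
by rewrite mulr0 mule0.
Qed.

Lemma weight_le1 (T : R) (phi : R -> R) : 0 < T -> weight T phi ->
  (\int[lam]_t `|phi t|%:E <= 1)%E.
Proof.
move=> T0 [mphi phiT].
have TV0 : 0 <= T^-1 by rewrite invr_ge0 ltW.
have -> : (1 = (T^-1 * (T - 0))%:E :> \bar R)%E by rewrite subr0 mulVf// gt_eqF.
rewrite -itv_int ?(ltW T0)//; apply: ge0_le_integral => //.
- by apply/measurable_EFinP; apply: measurableT_comp.
- by apply/measurable_EFinP; apply: measurable_funM => //; exact: measurable_indic.
- by move=> t _; rewrite lee_fin.
Qed.

Lemma weight_integrable (T : R) (phi : R -> R) : 0 < T -> weight T phi ->
  lam.-integrable setT (EFin \o phi).
Proof.
move=> T0 wphi; have mphi := wphi.1; apply/integrableP; split.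
  by apply/measurable_EFinP.
by rewrite (le_lt_trans (weight_le1 T0 wphi))// ltry.
Qed.

(** A weight gives mass at most 2 A / T to a window of half-width A: this is why
    a covariance that is small away from the diagonal is negligible. *)
Lemma weight_window_le (T A c : R) (phi : R -> R) (s : R) :
  0 < T -> 0 <= A -> 0 <= c -> weight T phi ->
  (\int[lam]_t (`|phi t| * (c * \1_(`[(s - A)%R, (s + A)%R]%classic) t))%:E
     <= (c * (2 * A) / T)%:E)%E.
Proof.
move=> T0 A0 c0 [mphi phiT].
have TV0 : 0 <= T^-1 by rewrite invr_ge0 ltW.
have -> : c * (2 * A) / T = (c / T) * ((s + A) - (s - A)) by field; rewrite gt_eqF.
rewrite -itv_int ?divr_ge0//; [|lra|exact: ltW].
have m1 : measurable_fun [set: R] (\1_(`[(s - A)%R, (s + A)%R]%classic) : R -> R).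
  exact: measurable_indic.
apply: ge0_le_integral => //.
- by move=> t _; rewrite lee_fin !mulr_ge0.
- apply/measurable_EFinP; apply: measurable_funM; first exact: measurableT_comp.
  exact: measurable_funM.
- by apply/measurable_EFinP; exact: measurable_funM.
- move=> t _; rewrite lee_fin [c / T]mulrC -mulrA ler_wpM2r ?mulr_ge0//.
  by rewrite (le_trans (phiT t))// ler_piMr// indicE lern1 leq_b1.
Qed.

End weights.

Section averages.
Context d (Omega : measurableType d) (R : realType) (P : probability Omega R).
Variable xi : R -> Omega -> R.
Hypothesis xi_meas : measurable_process xi.
Notation lam := (@lebesgue_measure R).

Lemma path_measurable (f : R -> R) (w : Omega) : measurable_fun [set: R] f ->
  measurable_fun [set: R] (fun t => f (xi t w)).
Proof.
move=> mf; apply: (measurableT_comp mf).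
exact: (measurable_fun_pair1 w xi_meas).
Qed.

Lemma section_measurable (f : R -> R) (t : R) : measurable_fun [set: R] f ->
  measurable_fun setT (fun w => f (xi t w)).
Proof.
move=> mf; apply: (measurableT_comp mf).
exact: (measurable_fun_pair2 t xi_meas).
Qed.

Lemma path_integrable (f : R -> R) (M T : R) (phi : R -> R) (w : Omega) :
  measurable_fun [set: R] f -> (forall x, `|f x| <= M) -> 0 < T -> weight T phi ->
  lam.-integrable setT (fun t => (f (xi t w) * phi t)%:E).
Proof.
move=> mf fM T0 wphi.
apply: (@integrableMr _ _ _ lam setT measurableT (fun t => f (xi t w)) (EFin \o phi)).
- exact: path_measurable.
- exists M; split; first exact: num_real.
  by move=> y My t _ /=; rewrite (le_trans (fM _))// ltW.
- exact: weight_integrable wphi.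
Qed.

Lemma path_average_le (f : R -> R) (M T : R) (phi : R -> R) (w : Omega) : 0 <= M ->
  measurable_fun [set: R] f -> (forall x, `|f x| <= M) -> 0 < T -> weight T phi ->
  `|\int[lam]_t (f (xi t w) * phi t)| <= M.
Proof.
move=> M0 mf fM T0 wphi.
have fint := path_integrable w mf fM T0 wphi.
have phii := weight_integrable T0 wphi.
rewrite -lee_fin EFin_normr_Rintegral//.
apply: le_trans (le_abse_integral _ _ _) _ => //; first exact: measurable_int fint.
apply: (@le_trans _ _ (\int[lam]_t (M%:E * `|phi t|%:E))%E).
  apply: ge0_le_integral => //.
  - by apply: measurableT_comp => //; exact: measurable_int fint.
  - apply: measurable_funeM; apply/measurable_EFinP; apply: measurableT_comp => //.
    by case: wphi.
  - by move=> t _; rewrite -EFinM lee_fin normrM ler_wpM2r.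
rewrite ge0_integralZl//; last by apply/measurable_EFinP; apply: measurableT_comp => //; case: wphi.
by rewrite -[leRHS]mule1 lee_wpmul2l// (weight_le1 T0 wphi).
Qed.

(** Fubini's theorem for the expectation and the time average. It is used twice
    to compute the second moment of an average: once with Y the average itself
    and once with Y the value of the process at a fixed time. *)
Lemma average_exchange (f : R -> R) (M K T : R) (phi : R -> R) (Y : Omega -> R) :
  measurable_fun [set: R] f -> (forall x, `|f x| <= M) -> 0 < T -> weight T phi ->
  measurable_fun setT Y -> (forall w, `|Y w| <= K) -> 0 <= K ->
  [/\ measurable_fun setT (fun w => \int[lam]_t (f (xi t w) * phi t)),
      lam.-integrable setT (fun t => (phi t * \int[P]_w (Y w * f (xi t w)))%:E) &
      \int[P]_w (Y w * \int[lam]_t (f (xi t w) * phi t)) =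
      \int[lam]_t (phi t * \int[P]_w (Y w * f (xi t w)))].
Proof.
move=> mf fM T0 wphi mY YK K0; have mphi := wphi.1.
have M0 : 0 <= M by apply: le_trans (fM 0).
pose F (p : measurableTypeR R * Omega) : \bar R := (f (xi p.1 p.2) * phi p.1)%:E.
pose G (p : measurableTypeR R * Omega) : \bar R := (phi p.1 * (Y p.2 * f (xi p.1 p.2)))%:E.
have mfxi : measurable_fun setT (fun p : measurableTypeR R * Omega => f (xi p.1 p.2)).
  exact: (measurableT_comp mf).
have mphi1 : measurable_fun setT (fun p : measurableTypeR R * Omega => phi p.1).
  exact: (measurableT_comp mphi).
have mF : measurable_fun setT F.
  by apply/measurable_EFinP; exact: measurable_funM.
have mG : measurable_fun setT G.
  apply/measurable_EFinP; apply: measurable_funM => //; apply: measurable_funM => //.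
  exact: (measurableT_comp mY).
have mabsphi : measurable_fun [set: R] (fun t => `|phi t|%:E).
  by apply/measurable_EFinP; apply: measurableT_comp.
have int_bound (H : measurableTypeR R * Omega -> \bar R) (c : R) : 0 <= c ->
    measurable_fun setT H -> (forall p, (`|H p| <= (c * `|phi p.1|)%:E)%E) ->
    (lam \x P)%E.-integrable setT H.
  move=> c0 mH Hc; apply/(integrable12ltyP _ _ mH).
  apply: (@le_lt_trans _ _ (\int[lam]_t (c%:E * `|phi t|%:E))%E).
    apply: ge0_le_integral => //.
    - by move=> t _; exact: integral_ge0.
    - apply: (measurable_fun_fubini_tonelli_F (abse \o H)).
        exact: measurableT_comp.
      by move=> p; exact: abse_ge0.
    - exact: measurable_funeM.
    - move=> t _; apply: (@le_trans _ _ (\int[P]_w (cst (c * `|phi t|)%:E w))%E).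
        apply: ge0_le_integral => //.
        apply: measurableT_comp => //; exact: (measurable_fun_pair2 t mH).
      by rewrite integral_cst//= probability_setT mule1.
  rewrite ge0_integralZl//; apply: (@le_lt_trans _ _ (c%:E * 1)%E).
    by rewrite lee_wpmul2l// (weight_le1 T0 wphi).
  by rewrite mule1 ltry.
have iF : (lam \x P)%E.-integrable setT F.
  apply: (int_bound _ M) => // p; rewrite lee_fin normrM ler_wpM2r//.
have iG : (lam \x P)%E.-integrable setT G.
  apply: (int_bound _ (K * M)); rewrite ?mulr_ge0// => p.
  by rewrite lee_fin !normrM mulrC ler_wpM2r// ler_pM.
have GPt t : (\int[P]_w G (t, w))%E = (phi t * \int[P]_w (Y w * f (xi t w)))%:E.
  have ii : P.-integrable setT (fun w => (Y w * f (xi t w))%:E).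
    apply: (@integrable_of_bounded _ _ _ _ _ (K * M)).
      by apply: measurable_funM => //; exact: section_measurable.
    by move=> w; rewrite normrM ler_pM.
  rewrite /G /=; under eq_integral do rewrite EFinM.
  rewrite integralZl// EFinM /Rintegral fineK//.
  exact: integrable_fin_num ii.
have GLw w : (\int[lam]_t G (t, w))%E = (Y w * \int[lam]_t (f (xi t w) * phi t))%:E.
  have ii := path_integrable w mf fM T0 wphi.
  rewrite /G /=; under eq_integral do rewrite mulrCA EFinM [(phi _ * _)%R]mulrC.
  rewrite integralZl// EFinM /Rintegral fineK//.
  exact: integrable_fin_num ii.
split.
- have := measurable_fubini_G iF; rewrite /fubini_G => mFG.
  by apply: (measurableT_comp _ mFG); exact: fine_measurable.
- by have := integrable_fubini_F iG; under [X in integrable _ _ X]eq_fun do rewrite GPt.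
- have := Fubini iG; under eq_integral do rewrite GPt.
  under [in X in _ = X]eq_integral do rewrite GLw.
  by rewrite /Rintegral => ->.
Qed.

End averages.

(** * Ergodic functions *)

Section ergodic.
Context d (Omega : measurableType d) (R : realType) (P : probability Omega R).
Variable xi : R -> Omega -> R.
Hypothesis xi_meas : measurable_process xi.
Notation lam := (@lebesgue_measure R).
Variable nu : probability (measurableTypeR R) R.
Hypothesis xi_law : forall t (A : set R), measurable A -> P (xi t @^-1` A) = nu A.

(** A law of large numbers for f along xi, uniform over all weights. It is
    required for every weight rather than for the constant one because the
    weights of the regression problem depend on T. *)
Definition ergodic (f : R -> R) := forall e : R, 0 < e ->
  \forall T \near +oo, forall phi, weight T phi ->
    outer_mean_le P
      (fun w => \int[lam]_t ((f (xi t w) - \int[nu]_x f x) * phi t)) e.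

Lemma integral_law (h : R -> \bar R) (t : R) : measurable_fun [set: R] h ->
  (forall x, 0 <= h x)%E -> (\int[P]_w h (xi t w) = \int[nu]_x h x)%E.
Proof.
move=> mh h0.
have mX : measurable_fun setT (xi t : Omega -> measurableTypeR R).
  exact: (section_measurable xi_meas t (@measurable_id _ _ setT)).
pose X : {mfun Omega >-> measurableTypeR R} :=
  HB.pack (xi t : Omega -> measurableTypeR R) (isMeasurableFun.Build _ _ _ _ _ mX).
rewrite -(ge0_integral_distribution X)//.
by apply: eq_measure_integral => A mA _; exact: xi_law.
Qed.

Lemma Rintegral_law (f : R -> R) (M t : R) : measurable_fun [set: R] f ->
  (forall x, `|f x| <= M) -> \int[P]_w f (xi t w) = \int[nu]_x f x.
Proof.
move=> mf fM.
have mX : measurable_fun setT (xi t : Omega -> measurableTypeR R).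
  exact: (section_measurable xi_meas t (@measurable_id _ _ setT)).
pose X : {mfun Omega >-> measurableTypeR R} :=
  HB.pack (xi t : Omega -> measurableTypeR R) (isMeasurableFun.Build _ _ _ _ _ mX).
congr fine; transitivity (\int[distribution P X]_x (f x)%:E)%E; last first.
  by apply: eq_measure_integral => A mA _; exact: xi_law.
rewrite (integral_distribution (X := X))//; first exact/measurable_EFinP.
apply: (@integrable_of_bounded _ _ _ P (fun w => f (xi t w)) M) => [|w]; last exact: fM.
exact: (section_measurable xi_meas t mf).
Qed.

(** By stationarity and Tonelli's theorem the average of |h (xi t)| against a
    weight is controlled in mean by the L1 norm of h. *)
Lemma integral_path_weight_le (h : R -> R) (e T : R) (phi : R -> R) :
  measurable_fun [set: R] h -> (forall x, 0 <= h x) ->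
  (\int[nu]_x (h x)%:E <= e%:E)%E -> 0 < T -> weight T phi ->
  measurable_fun setT (fun w => \int[lam]_t (h (xi t w) * `|phi t|)%:E)%E /\
  (\int[P]_w \int[lam]_t (h (xi t w) * `|phi t|)%:E <= e%:E)%E.
Proof.
move=> mh h0 he T0 wphi; have mphi := wphi.1.
pose F (p : measurableTypeR R * Omega) : \bar R := (h (xi p.1 p.2) * `|phi p.1|)%:E.
have mF : measurable_fun setT F.
  apply/measurable_EFinP; apply: measurable_funM; first exact: (measurableT_comp mh).
  have mphi1 : measurable_fun setT (fun p : measurableTypeR R * Omega => phi p.1).
    exact: (measurableT_comp mphi).
  exact: measurableT_comp mphi1.
have F0 p : (0 <= F p)%E by rewrite lee_fin mulr_ge0.
split; first exact: (measurable_fun_fubini_tonelli_G F).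
have mEh : measurable_fun [set: R] (fun x => (h x)%:E) by apply/measurable_EFinP.
have e0 : (0 <= e%:E)%E by apply: le_trans he; apply: integral_ge0 => x _; rewrite lee_fin.
rewrite -(@fubini_tonelli _ _ _ _ _ lam P F)//.
have mabsphi : measurable_fun [set: R] (fun t => `|phi t|%:E).
  by apply/measurable_EFinP; apply: measurableT_comp.
apply: (@le_trans _ _ (\int[lam]_t (e%:E * `|phi t|%:E))%E).
  apply: ge0_le_integral => //.
  - by move=> t _; apply: integral_ge0 => w _; exact: F0.
  - exact: measurable_fun_fubini_tonelli_F.
  - exact: measurable_funeM.
  - move=> t _; rewrite /F /=; under eq_integral do rewrite EFinM.
    rewrite ge0_integralZr//.
    + by rewrite (@integral_law (fun x => (h x)%:E))// lee_wpmul2r.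
    + by apply/measurable_EFinP; exact: (section_measurable xi_meas).
    + by move=> w _; rewrite lee_fin.
rewrite ge0_integralZl//.
by rewrite -[leRHS]mule1 lee_wpmul2l// (weight_le1 T0 wphi).
Qed.

(** The class of ergodic functions is closed in L1(nu): replacing f by g costs at
    most twice their L1 distance, once for the function and once for its mean.
    If the path of |f - g| is not integrable, the majorant is infinite. *)
Lemma ergodic_approx (f : R -> R) : nu.-integrable setT (EFin \o f) ->
  (forall e : R, 0 < e -> exists g : R -> R, [/\ measurable_fun [set: R] g,
     exists M : R, forall x, `|g x| <= M, ergodic g &
     (\int[nu]_x `|f x - g x|%:E <= e%:E)%E]) ->
  ergodic f.
Proof.
move=> intf H e e0.
have mf : measurable_fun [set: R] f by apply/measurable_EFinP; exact: measurable_int intf.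
have [|g [mg [M gM] ergg fge]] := H (e / 3); first by rewrite divr_gt0.
have e30 : 0 < e / 3 by rewrite divr_gt0.
pose mF := \int[nu]_x f x; pose mG := \int[nu]_x g x.
have intg : nu.-integrable setT (EFin \o g).
  by apply: (@integrable_of_bounded _ _ _ _ _ M).
have mfg : `|mF - mG| <= e / 3.
  rewrite -lee_fin; apply: le_trans fge; rewrite -RintegralB//.
  have ifg : nu.-integrable setT (EFin \o (fun x => f x - g x)).
    by rewrite /comp; under eq_fun do rewrite EFinB; exact: integrableB.
  rewrite EFin_normr_Rintegral//; apply: le_abse_integral => //.
  exact: measurable_int ifg.
pose h x := `|f x - g x| + `|mF - mG|.
have mh : measurable_fun [set: R] h.
  by apply: measurable_funD => //; apply: measurableT_comp => //; exact: measurable_funB.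
have h0 x : 0 <= h x by rewrite addr_ge0.
have he : (\int[nu]_x (h x)%:E <= (e / 3 + e / 3)%:E)%E.
  under eq_integral do rewrite EFinD.
  rewrite ge0_integralD//; last first.
    by apply/measurable_EFinP; apply: measurableT_comp => //; exact: measurable_funB.
  rewrite EFinD; apply: leeD => //.
  by rewrite integral_cst//= probability_setT mule1 lee_fin.
have := ergg _ e30; apply: filterS2 (nbhs_pinfty_gt (num_real 0)) => T T0 ergT phi wphi.
have [mY2 Y2e] := integral_path_weight_le mh h0 he T0 wphi.
have [Y1 [mY1 ZY1 E1]] := ergT phi wphi.
pose Y2 w := (\int[lam]_t (h (xi t w) * `|phi t|)%:E)%E.
have Y1_ge0 w : (0 <= Y1 w)%E by apply: le_trans (ZY1 w); rewrite lee_fin.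
have Y2_ge0 w : (0 <= Y2 w)%E.
  by apply: integral_ge0 => t _; rewrite lee_fin mulr_ge0.
exists (fun w => Y1 w + Y2 w)%E; split; first exact: emeasurable_funD.
  move=> w; have [Y2fin|Y2oo] := ltP (Y2 w) +oo%E; last first.
    have -> : Y2 w = +oo%E by apply/eqP; rewrite -leye_eq.
    by rewrite addey ?leey// -ltNye (lt_le_trans _ (Y1_ge0 w)).
  have mpath (k : R -> R) : measurable_fun [set: R] k ->
      measurable_fun [set: R] (fun t => k (xi t w) * phi t).
    by move=> mk; apply: measurable_funM; [exact: (path_measurable xi_meas)|exact: wphi.1].
  have ih : lam.-integrable setT (fun t => (h (xi t w) * `|phi t|)%:E).
    apply/integrableP; split.
      apply/measurable_EFinP; apply: measurable_funM; first exact: (path_measurable xi_meas).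
      by apply: measurableT_comp => //; exact: wphi.1.
    under eq_integral do rewrite gee0_abs ?lee_fin ?mulr_ge0//.
    exact: Y2fin.
  pose dlt x := (f x - mF) - (g x - mG).
  have mdlt : measurable_fun [set: R] dlt.
    by apply: measurable_funB; apply: measurable_funB.
  have dlth x : `|dlt x| <= h x.
    have -> : dlt x = (f x - g x) - (mF - mG) by rewrite /dlt; ring.
    by rewrite (le_trans (ler_normB _ _)).
  have id : lam.-integrable setT (fun t => (dlt (xi t w) * phi t)%:E).
    apply: (le_integrable measurableT _ _ ih) => [|t _].
      by apply/measurable_EFinP; exact: mpath.
    by rewrite /= lee_fin !normrM normr_id (ger0_norm (h0 _)) ler_wpM2r.
  have ig : lam.-integrable setT (fun t => ((g (xi t w) - mG) * phi t)%:E).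
    apply: (path_integrable (f := fun x => g x - mG) (M := M + `|mG|) xi_meas w _ _ T0 wphi).
      exact: measurable_funB.
    by move=> x; rewrite (le_trans (ler_normB _ _))// lerD2r.
  have -> : \int[lam]_t ((f (xi t w) - mF) * phi t) =
      \int[lam]_t ((g (xi t w) - mG) * phi t) + \int[lam]_t (dlt (xi t w) * phi t).
    by rewrite -RintegralD//; apply: eq_Rintegral => t _; rewrite /dlt; ring.
  apply: (@le_trans _ _ (`|\int[lam]_t ((g (xi t w) - mG) * phi t)|%:E +
      `|\int[lam]_t (dlt (xi t w) * phi t)|%:E)%E).
    by rewrite -EFinD lee_fin ler_normD.
  apply: leeD; first exact: ZY1.
  rewrite EFin_normr_Rintegral//; apply: le_trans (le_abse_integral _ _ _) _ => //.
    exact: measurable_int id.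
  apply: ge0_le_integral => //.
  - by apply: measurableT_comp => //; exact: measurable_int id.
  - exact: measurable_int ih.
  - by move=> t _; rewrite /= lee_fin normrM ler_wpM2r.
rewrite ge0_integralD//.
have -> : e = e / 3 + (e / 3 + e / 3) by field.
by rewrite EFinD; exact: leeD.
Qed.

End ergodic.

Section ergodic_class.
Context d (Omega : measurableType d) (R : realType) (P : probability Omega R).
Variable xi : R -> Omega -> R.
Hypothesis xi_meas : measurable_process xi.
Notation lam := (@lebesgue_measure R).
Variable nu : probability (measurableTypeR R) R.
Hypothesis xi_law : forall t (A : set R), measurable A -> P (xi t @^-1` A) = nu A.
Notation ergodic := (ergodic P xi nu).

Definition bounded_measurable (f : R -> R) :=
  measurable_fun [set: R] f /\ exists M : R, forall x, `|f x| <= M.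

Lemma bounded_measurable_int (f : R -> R) : bounded_measurable f ->
  nu.-integrable setT (EFin \o f).
Proof. by move=> [mf [M fM]]; apply: (@integrable_of_bounded _ _ _ _ _ M). Qed.

Lemma bounded_measurableB (f : R -> R) (c : R) : bounded_measurable f ->
  exists M : R, [/\ 0 <= M, measurable_fun [set: R] (fun x => f x - c) &
                forall x, `|f x - c| <= M].
Proof.
move=> [mf [M fM]]; exists (M + `|c|); split.
- by rewrite addr_ge0// (le_trans _ (fM 0)).
- exact: measurable_funB.
- by move=> x; rewrite (le_trans (ler_normB _ _))// lerD2r.
Qed.

Lemma bounded_measurable_pathint (f : R -> R) (c T : R) (phi : R -> R) w : bounded_measurable f ->
  0 < T -> weight T phi ->
  lam.-integrable setT (fun t => ((f (xi t w) - c) * phi t)%:E).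
Proof.
move=> /(bounded_measurableB c)[M [M0 mf fM]] T0 wphi.
exact: (path_integrable (f := fun x => f x - c) xi_meas w mf fM T0 wphi).
Qed.

Lemma ergodicD (f g : R -> R) : bounded_measurable f -> bounded_measurable g ->
  ergodic f -> ergodic g -> ergodic (fun x => f x + g x).
Proof.
move=> bf bg ef eg e e0.
have e20 : 0 < e / 2 by rewrite divr_gt0.
apply: filterS3 (nbhs_pinfty_gt (num_real 0)) (ef _ e20) (eg _ e20) => T T0 efT egT phi wphi.
rewrite (_ : e = e / 2 + e / 2); last by field.
apply: (outer_mean_leD (efT phi wphi) (egT phi wphi)) => w.
apply: le_trans (ler_normD _ _); rewrite -RintegralD//; [|exact: (bounded_measurable_pathint _ _ bf T0 wphi)|
  exact: (bounded_measurable_pathint _ _ bg T0 wphi)].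
rewrite RintegralD//; [|exact: bounded_measurable_int..].
rewrite le_eqVlt; apply/orP; left; apply/eqP; congr `|_|.
by apply: eq_Rintegral => t _; ring.
Qed.

Lemma ergodicZ (f : R -> R) (c : R) : bounded_measurable f ->
  ergodic f -> ergodic (fun x => c * f x).
Proof.
move=> bf ef e e0.
have c0 : 0 < `|c| + 1 by rewrite ltr_wpDl.
have ec0 : 0 < e / (`|c| + 1) by rewrite divr_gt0.
apply: filterS2 (nbhs_pinfty_gt (num_real 0)) (ef _ ec0) => T T0 efT phi wphi.
rewrite (_ : e = (`|c| + 1) * (e / (`|c| + 1))); last by field; rewrite gt_eqF.
apply: (outer_mean_leZ (ltW c0) (efT phi wphi)) => w.
rewrite RintegralZl//; last exact: bounded_measurable_int.
rewrite (_ : \int[lam]_t _ = c * \int[lam]_t ((f (xi t w) - \int[nu]_x f x) * phi t)).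
  by rewrite normrM ler_wpM2r// lerDl.
rewrite -(RintegralZl _ measurableT (bounded_measurable_pathint _ _ bf T0 wphi)).
by apply: eq_Rintegral => t _; ring.
Qed.

Lemma ergodic_cst (c : R) : ergodic (cst c).
Proof.
move=> e e0; near=> T => phi wphi.
apply: (outer_mean_le_le (outer_mean_le_cst P (ltW e0))) => // w.
rewrite Rintegral_cst//= probability_setT mulr1.
under eq_Rintegral do rewrite subrr mul0r.
by rewrite Rintegral_cst// mul0r normr0.
Unshelve. all: by end_near. Qed.

(** By dominated convergence, bounded pointwise limits are L1 limits. *)
Lemma ergodic_lim (f : R -> R) (fn : nat -> R -> R) (M : R) :
  (forall n, measurable_fun [set: R] (fn n)) -> (forall n x, `|fn n x| <= M) ->
  (forall x, fn n x @[n --> \oo] --> f x) ->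
  (forall n, ergodic (fn n)) ->
  bounded_measurable f /\ ergodic f.
Proof.
move=> mfn fnM fnf efn.
have mf : measurable_fun [set: R] f.
  by apply: (measurable_fun_cvg (h := fn)) => // x _; exact: fnf.
have fM x : `|f x| <= M.
  have : `|fn n x| @[n --> \oo] --> `|f x| by apply: cvg_norm; exact: fnf.
  move=> cn; rewrite -(cvg_lim _ cn)//; apply: limr_le; last exact: nearW.
  by apply/cvg_ex; exists `|f x|.
have bf : bounded_measurable f by split; [|exists M].
split => //; apply: (ergodic_approx xi_meas xi_law).
  exact: bounded_measurable_int.
move=> e e0.
have [] := @dominated_convergence _ _ _ nu _ measurableT
  (fun n x => (fn n x)%:E) (fun x => (f x)%:E) (cst M%:E).
- by move=> n; apply/measurable_EFinP; exact: mfn.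
- by apply/measurable_EFinP; exact: mf.
- by apply: aeW => x _; apply: cvg_EFin; [exact: nearW|exact: fnf].
- by apply: (@integrable_of_bounded _ _ _ nu (cst M) `|M|).
- by apply: aeW => x n _ /=; rewrite lee_fin.
move=> _ + _ => /fine_cvgP[fin0 /cvgr0Pnorm_le /(_ _ e0)].
move=> le0; near \oo => n.
exists (fn n); split => //; first by exists M.
have fi : (\int[nu]_x `|(fn n x)%:E - (f x)%:E| \is a fin_num)%E by near: n; exact: fin0.
have : `|fine (\int[nu]_x `|(fn n x)%:E - (f x)%:E|)%E| <= e by near: n; exact: le0.
rewrite ger0_norm; last by rewrite fine_ge0// integral_ge0.
rewrite -lee_fin fineK// => fne.
by under eq_integral do rewrite distrC.
Unshelve. all: by end_near. Qed.

End ergodic_class.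

(** * Covariance decay implies ergodicity *)

Section decorrelation.
Context d (Omega : measurableType d) (R : realType) (P : probability Omega R).
Variable xi : R -> Omega -> R.
Hypothesis xi_meas : measurable_process xi.
Notation lam := (@lebesgue_measure R).
Variable nu : probability (measurableTypeR R) R.

Let norm_average_le (T C : R) (phi k : R -> R) : 0 < T -> weight T phi ->
  lam.-integrable setT (fun t => (phi t * k t)%:E) ->
  (\int[lam]_t (`|phi t * k t|)%:E <= C%:E)%E ->
  `|\int[lam]_t (phi t * k t)| <= C.
Proof.
move=> T0 wphi ik kC.
rewrite -lee_fin EFin_normr_Rintegral//; apply: le_trans kC.
by apply: le_abse_integral => //; exact: measurable_int ik.
Qed.

(** The mean square of the average Z is a double integral of the covariance
    against the weight; the part far from the diagonal is small by hypothesis,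
    the part near the diagonal is O(1/T). *)
Lemma ergodic_of_decay (f : R -> R) : bounded_measurable f ->
  (forall e : R, 0 < e -> exists A : R, forall s t, A < `|s - t| ->
     `|\int[P]_w ((f (xi s w) - \int[nu]_x f x) * (f (xi t w) - \int[nu]_x f x))| <= e) ->
  ergodic P xi nu f.
Proof.
move=> bf decay e e0; pose m := \int[nu]_x f x.
have [M [M0 mf fM]] := bounded_measurableB m bf.
pose g x := f x - m.
have M2 : 0 <= M ^+ 2 by exact: sqr_ge0.
have gM x : `|g x| <= M := fM x.
have e2 : 0 < e ^+ 2 / 2 by rewrite divr_gt0// exprn_gt0.
have [A0 HA] := decay _ e2; pose A := Num.max A0 0.
have A_ge0 : 0 <= A by rewrite /A le_max lexx orbT.
near=> T => phi wphi.
have T0 : 0 < T by near: T; exact: nbhs_pinfty_gt.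
have TA : M ^+ 2 * (2 * A) / T <= e ^+ 2 / 2.
  rewrite ler_pdivrMr// -ler_pdivrMl//; near: T; apply: nbhs_pinfty_ge; exact: num_real.
have mphi := wphi.1.
pose Z w := \int[lam]_t (g (xi t w) * phi t).
have Zle w : `|Z w| <= M by exact: (path_average_le xi_meas w M0 mf fM T0 wphi).
have msec t : measurable_fun setT (fun w => g (xi t w)).
  exact: (section_measurable xi_meas t mf).
(* K t is the correlation of the value at time t with the whole average *)
pose K t := \int[P]_w (g (xi t w) * Z w).
have KE t : [/\ measurable_fun setT Z,
    lam.-integrable setT (fun s => (phi s * \int[P]_w (g (xi t w) * g (xi s w)))%:E) &
    K t = \int[lam]_s (phi s * \int[P]_w (g (xi t w) * g (xi s w)))].
  exact: (average_exchange P xi_meas mf fM T0 wphi (msec t) (fun w => fM (xi t w)) M0).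
have [mZ _ _] := KE 0.
have [_ iK ZE] := average_exchange P xi_meas mf fM T0 wphi mZ Zle M0.
have corr_le t s : `|\int[P]_w (g (xi t w) * g (xi s w))| <= M ^+ 2.
  have ii : P.-integrable setT (fun w => (g (xi t w) * g (xi s w))%:E).
    apply: (@integrable_of_bounded _ _ _ P (fun w => g (xi t w) * g (xi s w)) (M ^+ 2)).
      by apply: measurable_funM; exact: msec.
    by move=> w; rewrite normrM expr2 ler_pM ?gM ?Zle.
  rewrite -lee_fin EFin_normr_Rintegral//; apply: le_trans (le_abse_integral _ _ _) _ => //.
    exact: measurable_int ii.
  apply: (@le_trans _ _ (\int[P]_w (cst (M ^+ 2)%:E w))%E).
    apply: ge0_le_integral => //.
      by apply: measurableT_comp => //; exact: measurable_int ii.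
    by move=> w _; rewrite /= lee_fin normrM expr2 ler_pM ?gM ?Zle.
  by rewrite integral_cst//= probability_setT mule1.
have KT t : `|K t| <= e ^+ 2.
  have [_ ik ->] := KE t.
  apply: (norm_average_le T0 wphi) => //.
  pose win s := M ^+ 2 * \1_(`[(t - A), (t + A)]%classic) s.
  have mwin : measurable_fun [set: R] win.
    by apply: measurable_funM => //; exact: measurable_indic.
  have mnphi : measurable_fun [set: R] (fun s => `|phi s|) by apply: measurableT_comp.
  apply: (@le_trans _ _ (\int[lam]_s ((e ^+ 2 / 2)%:E * `|phi s|%:E + (`|phi s| * win s)%:E))%E).
    apply: ge0_le_integral => //.
    - apply/measurable_EFinP; apply: measurableT_comp => //; apply/measurable_EFinP.
      exact: measurable_int ik.
    - apply: emeasurable_funD.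
        by apply: measurable_funeM; apply/measurable_EFinP.
      by apply/measurable_EFinP; exact: measurable_funM.
    - move=> s _; rewrite -EFinM -EFinD lee_fin normrM [X in _ <= X + _]mulrC -mulrDr.
      rewrite ler_wpM2l// /win indicE; case: (leP `|t - s| A) => ts.
        rewrite mem_set/=; last first.
          by rewrite in_itv/=; move: ts; rewrite ler_norml => /andP[? ?]; apply/andP; split; lra.
        by rewrite mulr1 (le_trans (corr_le _ _))// lerDr ltW.
      rewrite (le_trans (HA _ _ _))//; last by rewrite lerDl mulr_ge0 ?ler0n.
      by rewrite (le_lt_trans _ ts)// /A le_max lexx.
  rewrite ge0_integralD//; last first.
  - by apply/measurable_EFinP; exact: measurable_funM.
  - by move=> s _; rewrite lee_fin mulr_ge0// /win mulr_ge0.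
  - by apply: measurable_funeM; apply/measurable_EFinP.
  - by move=> s _; rewrite -EFinM lee_fin mulr_ge0// ltW.
  rewrite ge0_integralZl//; last 2 first.
  - by apply/measurable_EFinP.
  - by rewrite lee_fin ltW.
  have -> : ((e ^+ 2)%:E = (e ^+ 2 / 2)%:E + (e ^+ 2 / 2)%:E)%E.
    by rewrite -EFinD; congr (_%:E); field.
  apply: leeD.
    by rewrite -[leRHS]mule1 lee_wpmul2l ?lee_fin ?(ltW e2)// (weight_le1 T0 wphi).
  by rewrite (le_trans (weight_window_le t T0 A_ge0 _ wphi))// lee_fin.
have EZ2 : `|\int[P]_w (Z w * Z w)| <= e ^+ 2.
  rewrite /Z ZE; apply: (norm_average_le T0 wphi) => //.
  apply: (@le_trans _ _ (\int[lam]_s ((e ^+ 2)%:E * `|phi s|%:E))%E).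
    apply: ge0_le_integral => //.
    - apply/measurable_EFinP; apply: measurableT_comp => //; apply/measurable_EFinP.
      exact: measurable_int iK.
    - by apply: measurable_funeM; apply/measurable_EFinP; apply: measurableT_comp.
    - move=> s _; rewrite -EFinM lee_fin normrM mulrC ler_wpM2r//.
      rewrite (_ : \int[P]_w _ = K s); first exact: KT.
      by apply: eq_Rintegral => w _; rewrite mulrC.
  rewrite ge0_integralZl ?lee_fin ?sqr_ge0//; last by apply/measurable_EFinP; apply: measurableT_comp.
  by rewrite -[leRHS]mule1 lee_wpmul2l ?lee_fin ?sqr_ge0// (weight_le1 T0 wphi).
exists (fun w => `|Z w|%:E); split => //.
  by apply/measurable_EFinP; apply: measurableT_comp.
have iZ2 : P.-integrable setT (fun w => (Z w * Z w)%:E).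
  apply: (@integrable_of_bounded _ _ _ P (fun w => Z w * Z w) (M ^+ 2)).
    exact: measurable_funM.
  by move=> w; rewrite normrM expr2 ler_pM ?gM ?Zle.
(* from the second moment to the first one: |z| <= e / 2 + z^2 / (2 e) *)
apply: (@le_trans _ _ (\int[P]_w ((e / 2)%:E + ((2 * e)^-1)%:E * (Z w * Z w)%:E))%E).
  apply: ge0_le_integral => //.
  - by apply/measurable_EFinP; apply: measurableT_comp.
  - apply: emeasurable_funD => //; apply: measurable_funeM.
    exact: measurable_int iZ2.
  - move=> w _; rewrite -EFinM -EFinD lee_fin -(ler_pM2l (_ : 0 < 2 * e)) ?mulr_gt0//.
    rewrite mulrDr mulVKf ?gt_eqF ?mulr_gt0//.
    have -> : 2 * e * (e / 2) = e ^+ 2 by field.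
    rewrite -expr2 -real_normK ?num_real//.
    have := sqr_ge0 (`|Z w| - e); rewrite sqrrB; lra.
rewrite ge0_integralD//; last first.
- by apply: measurable_funeM; exact: measurable_int iZ2.
- by move=> w _; rewrite -EFinM lee_fin -expr2 mulr_ge0 ?sqr_ge0// invr_ge0 mulr_ge0// ltW.
- by move=> w _; rewrite lee_fin divr_ge0// ltW.
rewrite integral_cst//= probability_setT mule1 integralZl//.
have -> : (\int[P]_w (Z w * Z w)%:E = (\int[P]_w (Z w * Z w))%:E)%E.
  by rewrite /Rintegral fineK//; exact: integrable_fin_num iZ2.
rewrite -EFinM -EFinD lee_fin (@le_trans _ _ (e / 2 + (2 * e)^-1 * e ^+ 2))//.
  rewrite lerD2l ler_wpM2l ?invr_ge0 ?mulr_ge0 ?(ltW e0)//.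
  exact: le_trans (ler_norm _) EZ2.
by rewrite le_eqVlt; apply/orP; left; apply/eqP; field; rewrite gt_eqF.
Unshelve. all: by end_near. Qed.

End decorrelation.

Section cosines.
Context d (Omega : measurableType d) (R : realType) (P : probability Omega R).
Variable xi : R -> Omega -> R.
Hypothesis xi_meas : measurable_process xi.
Notation lam := (@lebesgue_measure R).
Variable nu : probability (measurableTypeR R) R.
Hypothesis xi_law : forall t (A : set R), measurable A -> P (xi t @^-1` A) = nu A.

Variable beta : R -> R.
Hypothesis beta_cvg0 : forall e : R, 0 < e -> exists A : R, forall t, A < `|t| -> `|beta t| <= e.
Hypothesis cos_one : forall (t a b : R),
  \int[P]_w cos (a * xi t w + b) = expR (- (a ^+ 2 / 2)) * cos b.
Hypothesis cos_add : forall (s t a b : R),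
  \int[P]_w cos (a * (xi s w + xi t w) + b) =
  expR (- (a ^+ 2 * (1 + beta (s - t)))) * cos b.
Hypothesis cos_sub : forall (s t a b : R),
  \int[P]_w cos (a * (xi s w - xi t w) + b) =
  expR (- (a ^+ 2 * (1 - beta (s - t)))) * cos b.

Lemma bounded_measurable_cos (a b : R) : bounded_measurable (fun x : R => cos (a * x + b)).
Proof.
split; first by apply: continuous_measurable_fun; exact: cos_affine_continuous.
by exists 1 => x; rewrite ler_norml cos_geN1 cos_le1.
Qed.

(** A product of two cosines is half the sum of the cosines of the sum and of the
    difference, whose means are explicit. The covariance is therefore
    expR (- a^2) / 2 times
    (expR (- a^2 beta) - 1) cos (2 b) + (expR (a^2 beta) - 1),
    which tends to 0 with beta. *)
Lemma ergodic_cos (a b : R) : ergodic P xi nu (fun x => cos (a * x + b)).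
Proof.
have bc := bounded_measurable_cos a b.
apply: (ergodic_of_decay xi_meas bc) => e e0.
have [mf [M fM]] := bc.
pose m := expR (- (a ^+ 2 / 2)) * cos b.
have -> : \int[nu]_x cos (a * x + b) = m.
  by rewrite -(@Rintegral_law _ _ _ _ _ xi_meas _ xi_law _ M 0 mf fM) cos_one.
have [r /= r0 Hr] : \forall y \near (0 : R), `|expR y - 1| <= e.
  have : expR y @[y --> (0 : R)] --> (1 : R).
    by rewrite -[X in _ --> X]expR0; exact: continuous_expR.
  move=> /cvgrPdist_le /(_ _ e0).
  by apply: filterS => y; rewrite distrC.
have a1 : 0 < a ^+ 2 + 1 by rewrite ltr_wpDl// sqr_ge0.
have ra : 0 < r / 2 / (a ^+ 2 + 1) by rewrite !divr_gt0.
have [A HA] := beta_cvg0 ra.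
exists A => s t /HA bst.
have small : `|a ^+ 2 * beta (s - t)| < r.
  rewrite normrM (ger0_norm (sqr_ge0 a)).
  apply: (@le_lt_trans _ _ ((a ^+ 2 + 1) * (r / 2 / (a ^+ 2 + 1)))).
    by rewrite ler_pM// ?sqr_ge0// lerDl.
  by rewrite mulrC divfK ?gt_eqF//; lra.
have msec (t' a' b' : R) : measurable_fun setT (fun w => cos (a' * xi t' w + b')).
  exact: (section_measurable xi_meas t' (bounded_measurable_cos a' b').1).
have msum (c a' b' : R) : measurable_fun setT (fun w => cos (a' * (xi s w + c * xi t w) + b')).
  apply: (measurableT_comp (bounded_measurable_cos a' b').1).
  apply: measurable_funD; first exact: (section_measurable xi_meas s (@measurable_id _ _ setT)).
  apply: measurable_funM => //; exact: (section_measurable xi_meas t (@measurable_id _ _ setT)).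
have ibnd (k : Omega -> R) : measurable_fun setT k -> (forall w, `|k w| <= 1) ->
    P.-integrable setT (fun w => (k w)%:E).
  by move=> mk k1; exact: (@integrable_of_bounded _ _ _ P k 1).
have cos1 (x : R) : `|cos x| <= 1 by rewrite ler_norml cos_geN1 cos_le1.
have i1 (t' : R) : P.-integrable setT (fun w => (cos (a * xi t' w + b))%:E) by exact: ibnd.
have iadd : P.-integrable setT (fun w => (cos (a * (xi s w + xi t w) + (b + b)))%:E).
  apply: ibnd => //; have := msum 1 a (b + b).
  by under eq_fun do rewrite mul1r.
have isub : P.-integrable setT (fun w => (cos (a * (xi s w - xi t w) + 0))%:E).
  apply: ibnd => //; have := msum (-1) a 0.
  by under eq_fun do rewrite mulN1r.
have iZ (k : Omega -> R) c : P.-integrable setT (fun w => (k w)%:E) ->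
    P.-integrable setT (fun w => (c * k w)%:E).
  by move=> ik; under eq_fun do rewrite EFinM; exact: integrableZl.
have iD (k k' : Omega -> R) : P.-integrable setT (fun w => (k w)%:E) ->
    P.-integrable setT (fun w => (k' w)%:E) -> P.-integrable setT (fun w => (k w + k' w)%:E).
  by move=> ik ik'; under eq_fun do rewrite EFinD; exact: integrableD.
have icst c : P.-integrable setT (fun w : Omega => c%:E).
  exact: (@integrable_of_bounded _ _ _ P (cst c) `|c|).
have -> : \int[P]_w ((cos (a * xi s w + b) - m) * (cos (a * xi t w + b) - m)) =
  \int[P]_w (2^-1 * cos (a * (xi s w + xi t w) + (b + b)) +
   (2^-1 * cos (a * (xi s w - xi t w) + 0) +
    ((- m) * cos (a * xi s w + b) + ((- m) * cos (a * xi t w + b) + m ^+ 2)))).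
  apply: eq_Rintegral => w _.
  have -> : a * (xi s w + xi t w) + (b + b) = (a * xi s w + b) + (a * xi t w + b) by ring.
  have -> : a * (xi s w - xi t w) + 0 = (a * xi s w + b) - (a * xi t w + b) by ring.
  by move: (a * xi s w + b) (a * xi t w + b) => x y; rewrite cosD cosB; field.
have h3 := iD _ _ (iZ _ (- m) (i1 t)) (icst (m ^+ 2)).
have h2 := iD _ _ (iZ _ (- m) (i1 s)) h3.
have h1 := iD _ _ (iZ _ 2^-1 isub) h2.
rewrite (RintegralD measurableT (iZ _ 2^-1 iadd) h1).
rewrite (RintegralD measurableT (iZ _ 2^-1 isub) h2).
rewrite (RintegralD measurableT (iZ _ (- m) (i1 s)) h3).
rewrite (RintegralD measurableT (iZ _ (- m) (i1 t)) (icst (m ^+ 2))).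
rewrite (RintegralZl _ measurableT iadd) (RintegralZl _ measurableT isub).
rewrite (RintegralZl _ measurableT (i1 s)) (RintegralZl _ measurableT (i1 t)).
rewrite [X in _ + (_ + (_ + (_ + X)))]Rintegral_cst//= probability_setT mulr1.
rewrite !cos_one cos_add cos_sub -/m cos0.
set B := beta (s - t) in small *.
have -> : - (a ^+ 2 * (1 + B)) = - (a ^+ 2) + - (a ^+ 2 * B) by ring.
have -> : - (a ^+ 2 * (1 - B)) = - (a ^+ 2) + a ^+ 2 * B by ring.
rewrite !expRD.
have m2 : m ^+ 2 = expR (- a ^+ 2) * (1 + cos (b + b)) / 2.
  rewrite /m cosD -expr2 -expr2 sin2cos2 exprMn expr2 -expRD.
  have -> : - (a ^+ 2 / 2) + - (a ^+ 2 / 2) = - a ^+ 2 by field.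
  by field.
set E := expR (- a ^+ 2) in m2 *.
set X := expR (- (a ^+ 2 * B)); set Y := expR (a ^+ 2 * B); set C := cos (b + b).
have -> : 2^-1 * (E * X * C) + (2^-1 * (E * Y * 1) + (- m * m + (- m * m + m ^+ 2))) =
  E * ((X - 1) * C + (Y - 1)) / 2.
  have -> : 2^-1 * (E * X * C) + (2^-1 * (E * Y * 1) + (- m * m + (- m * m + m ^+ 2))) =
     2^-1 * (E * X * C) + 2^-1 * (E * Y) - m ^+ 2 by ring.
  by rewrite m2 -/C; field.
have E1 : `|E| <= 1.
  rewrite ger0_norm ?expR_ge0// /E -[leRHS]expR0 ler_expR oppr_le0; exact: sqr_ge0.
have X1 : `|X - 1| <= e by apply: Hr; rewrite /= sub0r opprK.
have Y1 : `|Y - 1| <= e by apply: Hr; rewrite /= sub0r normrN.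
have C1 : `|C| <= 1 := cos1 _.
rewrite !normrM (_ : `|2^-1| = 2^-1 :> R); last by rewrite ger0_norm.
rewrite ler_pdivrMr//.
apply: (@le_trans _ _ (1 * (e * 1 + e))); last by lra.
apply: ler_pM => //; rewrite (le_trans (ler_normD _ _))// lerD// normrM.
exact: ler_pM.
Qed.

End cosines.

(** * From cosines to integrable functions *)

Section power_step.
Context {R : realType}.

Let bernoulli_ge (a : R) n : 0 <= a -> 1 + n%:R * a <= (1 + a) ^+ n.
Proof.
move=> a0; elim: n => [|n IH]; first by rewrite expr0 mul0r addr0.
rewrite exprS (@le_trans _ _ ((1 + a) * (1 + n%:R * a)))//; last first.
  by rewrite ler_wpM2l// addr_ge0.
rewrite -natr1; have : 0 <= n%:R * a * a by rewrite !mulr_ge0.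
lra.
Qed.

Let bernoulli_le (a : R) n : 0 <= a -> a <= 1 -> 1 - n%:R * a <= (1 - a) ^+ n.
Proof.
move=> a0 a1; elim: n => [|n IH]; first by rewrite expr0 mul0r subr0.
rewrite exprS (@le_trans _ _ ((1 - a) * (1 - n%:R * a)))//; last first.
  by rewrite ler_wpM2l// subr_ge0.
rewrite -natr1; have : 0 <= n%:R * a * a by rewrite !mulr_ge0.
lra.
Qed.

Let natM_expr_cvg0 (z : R) : 0 <= z -> z < 1 -> n%:R * z ^+ n @[n --> \oo] --> 0.
Proof.
move=> z0 z1.
have [->|zn0] := eqVneq z 0.
  apply: cvg_near_cst; exists 1 => // n /= n0.
  by rewrite expr0n eqn0Ngt n0/= mulr0.
have zp : 0 < z by rewrite lt_neqAle eq_sym zn0.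
pose w := Num.sqrt z.
have w0 : 0 < w by rewrite sqrtr_gt0.
have w1 : w < 1 by rewrite -sqrtr1 ltr_sqrt.
have zE : z = w * w by rewrite -expr2 sqr_sqrtr.
pose h := w^-1 - 1.
have h0 : 0 < h by rewrite subr_gt0 -[ltLHS]invr1 ltf_pV2// posrE.
have nw (n : nat) : n%:R * w ^+ n <= h^-1.
  rewrite -ler_pdivlMr ?exprn_gt0// -exprVn -ler_pdivrMl ?invr_gt0// invrK.
  rewrite (_ : w^-1 = 1 + h); last by rewrite /h; ring.
  by rewrite (le_trans _ (bernoulli_ge n (ltW h0)))// mulrC lerDr.
have cw : h^-1 * w ^+ n @[n --> \oo] --> (0 : R).
  rewrite -[X in _ --> X](mulr0 h^-1); apply: cvgMr; apply: cvg_expr.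
  by rewrite gtr0_norm.
apply: (squeeze_cvgr _ (cvg_cst 0) cw); apply: nearW => n.
by rewrite mulr_ge0 ?exprn_ge0//= zE exprMn mulrA ler_wpM2r// exprn_ge0// ltW.
Qed.

(** An explicit Weierstrass approximation of a step. By Bernoulli's inequality
    the polynomial is at least 1 - n (2 y)^n, which tends to 1 if y < 1/2, and at
    most 1 / (1 + n (2 y)^n) <= 1 / (1 + n) otherwise. The factor n in the
    exponent is there for the threshold y = 1/2 itself. *)
Lemma power_step_cvg (y : R) : 0 <= y -> y <= 1 ->
  (1 - y ^+ n) ^+ (n * 2 ^ n) @[n --> \oo] --> ((y < 2^-1)%R%:R : R).
Proof.
move=> y0 y1.
have yn0 n : 0 <= y ^+ n by exact: exprn_ge0.
have yn1 n : y ^+ n <= 1 by exact: exprn_ile1.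
have nE (n : nat) : (n * 2 ^ n)%:R * y ^+ n = n%:R * (2 * y) ^+ n.
  by rewrite natrM natrX exprMn mulrA.
have [ylt|yge] := ltP y 2^-1; rewrite /= ?mulr1n ?mulr0n.
  have z1 : 2 * y < 1 by lra.
  have c1 : (1 - n%:R * (2 * y) ^+ n) @[n --> \oo] --> (1 : R).
    rewrite -[X in _ --> X]subr0; apply: cvgB; first exact: cvg_cst.
    by apply: natM_expr_cvg0 => //; rewrite mulr_ge0.
  have c2 : (fun _ : nat => 1 : R) n @[n --> \oo] --> (1 : R) by exact: cvg_cst.
  apply: squeeze_cvgr c1 c2; apply: nearW => n.
  rewrite -nE bernoulli_le//=; apply: exprn_ile1; rewrite ?subr_ge0//.
  by rewrite lerBlDr lerDl.
apply: (squeeze_cvgr _ (cvg_cst 0) (@cvg_harmonic R)); apply: nearW => n.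
rewrite exprn_ge0 ?subr_ge0//= /harmonic.
set k := (n * 2 ^ n)%N.
have k1 : (1 - y ^+ n) ^+ k * (1 + k%:R * y ^+ n) <= 1.
  apply: (@le_trans _ _ ((1 - y ^+ n) ^+ k * (1 + y ^+ n) ^+ k)).
    by rewrite ler_wpM2l ?bernoulli_ge// exprn_ge0 ?subr_ge0.
  rewrite -exprMn -subr_sqr expr1n; apply: exprn_ile1.
    by rewrite subr_ge0 exprn_ile1.
  by rewrite lerBlDr lerDl sqr_ge0.
have nk : n.+1%:R <= 1 + k%:R * y ^+ n.
  rewrite nE -natr1 addrC lerD2l ler_peMr// exprn_ege1//; lra.
rewrite -[leRHS]mul1r ler_pdivlMr// (le_trans _ k1)// ler_wpM2l// exprn_ge0//.
by rewrite subr_ge0.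
Qed.

End power_step.

Section density.
Context d (Omega : measurableType d) (R : realType) (P : probability Omega R).
Variable xi : R -> Omega -> R.
Hypothesis xi_meas : measurable_process xi.
Variable nu : probability (measurableTypeR R) R.
Hypothesis xi_law : forall t (A : set R), measurable A -> P (xi t @^-1` A) = nu A.
Hypothesis erg_cos : forall a b : R, ergodic P xi nu (fun x => cos (a * x + b)).
Notation ergodic := (ergodic P xi nu).

Lemma bounded_measurableM (f g : R -> R) : bounded_measurable f -> bounded_measurable g ->
  bounded_measurable (fun x => f x * g x).
Proof.
move=> [mf [M fM]] [mg [K gK]]; split; first exact: measurable_funM.
by exists (M * K) => x; rewrite normrM ler_pM.
Qed.

Lemma bounded_measurableD (f g : R -> R) : bounded_measurable f -> bounded_measurable g ->
  bounded_measurable (fun x => f x + g x).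
Proof.
move=> [mf [M fM]] [mg [K gK]]; split; first exact: measurable_funD.
by exists (M + K) => x; rewrite (le_trans (ler_normD _ _))// lerD.
Qed.

Lemma bounded_measurable_cst (c : R) : bounded_measurable (fun _ : R => c).
Proof. by split => //; exists `|c|. Qed.

(** Products with all cosines are part of the invariant so that multiplication by
    a further cosine preserves it, through the product formula. *)
Definition cos_ergodic (f : R -> R) := bounded_measurable f /\
  forall a b : R, ergodic (fun x => f x * cos (a * x + b)).

(** Multipliers form an algebra that contains the constants and the cosines:
    all polynomials in a cosine are obtained by closure properties, with no
    explicit trigonometric sums. *)
Definition multiplier (g : R -> R) :=
  forall f, cos_ergodic f -> cos_ergodic (fun x => g x * f x).

Lemma multiplier_cst (c : R) : multiplier (fun _ => c).
Proof.
move=> f [bf ef]; split; first exact: (bounded_measurableM (bounded_measurable_cst c) bf).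
move=> a b; under eq_fun do rewrite -mulrA.
apply: (ergodicZ xi_meas) => //; exact: (bounded_measurableM bf (bounded_measurable_cos a b)).
Qed.

Lemma multiplierM (g1 g2 : R -> R) : multiplier g1 -> multiplier g2 ->
  multiplier (fun x => g1 x * g2 x).
Proof.
by move=> m1 m2 f cf; under eq_fun do rewrite -mulrA; apply: m1; exact: m2.
Qed.

Lemma multiplierD (g1 g2 : R -> R) : multiplier g1 -> multiplier g2 ->
  multiplier (fun x => g1 x + g2 x).
Proof.
move=> m1 m2 f cf; have [b1 e1] := m1 f cf; have [b2 e2] := m2 f cf.
under eq_fun do rewrite mulrDl; split; first exact: bounded_measurableD.
move=> a b; under eq_fun do rewrite mulrDl; apply: (ergodicD xi_meas) => //;
  exact: (bounded_measurableM _ (bounded_measurable_cos a b)).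
Qed.

Lemma multiplierX (g : R -> R) n : multiplier g -> multiplier (fun x => g x ^+ n).
Proof.
move=> mg; elim: n => [|n IH]; first exact: multiplier_cst.
by under eq_fun do rewrite exprS; exact: multiplierM.
Qed.

Lemma multiplier_cos (c e : R) : multiplier (fun x => cos (c * x + e)).
Proof.
move=> f [bf ef]; have bc (a b : R) := bounded_measurable_cos a b.
split; first exact: (bounded_measurableM (bc c e) bf).
move=> a b.
have -> : (fun x => cos (c * x + e) * f x * cos (a * x + b)) =
   (fun x => 2^-1 * (f x * cos ((c + a) * x + (e + b))) +
             2^-1 * (f x * cos ((c - a) * x + (e - b)))).
  apply/funext => x.
  have -> : (c + a) * x + (e + b) = (c * x + e) + (a * x + b) by ring.
  have -> : (c - a) * x + (e - b) = (c * x + e) - (a * x + b) by ring.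
  by move: (c * x + e) (a * x + b) => u v; rewrite cosD cosB; field.
have bfc a' b' := bounded_measurableM bf (bc a' b').
have bfc2 a' b' := bounded_measurableM (bounded_measurable_cst 2^-1) (bfc a' b').
by apply: (ergodicD xi_meas) => //; apply: (ergodicZ xi_meas).
Qed.

Lemma multiplier_ergodic (g : R -> R) : multiplier g -> bounded_measurable g /\ ergodic g.
Proof.
move=> mg; have c1 : cos_ergodic (fun _ => 1).
  by split=> [|a b]; [exact: bounded_measurable_cst|under eq_fun do rewrite mul1r; exact: erg_cos].
have [bg eg] := mg _ c1; split; first by move: bg; under eq_fun do rewrite mulr1.
have := eg 0 0.
by under eq_fun do rewrite mul0r addr0 cos0 !mulr1.
Qed.


(** The step polynomials, composed with an affine function y of sin (x / N) that
    takes values in [0, 1] and equals 1/2 at x = c. *)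
Let half_line_sin (c N : R) : ergodic (fun x => (sin (x / N) < sin (c / N))%R%:R).
Proof.
pose y x := (2^-1 - sin (c / N) / 4) + 4^-1 * cos (N^-1 * x + - (pi / 2)).
have yE x : y x = 2^-1 + (sin (x / N) - sin (c / N)) / 4.
  by rewrite /y cosBpihalf [N^-1 * x]mulrC; field.
have my : multiplier y.
  apply: multiplierD; first exact: multiplier_cst.
  by apply: multiplierM; [exact: multiplier_cst|exact: multiplier_cos].
have y01 x : 0 <= y x <= 1.
  rewrite yE; have := sin_le1 (x / N); have := sin_geN1 (x / N).
  have := sin_le1 (c / N); have := sin_geN1 (c / N) => *.
  by apply/andP; split; lra.
pose p n x := (1 + (-1) * y x ^+ n) ^+ (n * 2 ^ n).
have mp n : multiplier (p n).
  apply: multiplierX; apply: multiplierD; first exact: multiplier_cst.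
  by apply: multiplierM; [exact: multiplier_cst|exact: multiplierX].
have [//| | | |_] := @ergodic_lim _ _ _ _ _ xi_meas _ xi_law
  (fun x => (sin (x / N) < sin (c / N))%R%:R) p 1.
- by move=> n; have [[]] := multiplier_ergodic (mp n).
- move=> n x; have /andP[y0 y1] := y01 x.
  have yn0 : 0 <= y x ^+ n by exact: exprn_ge0.
  have yn1 : y x ^+ n <= 1 by exact: exprn_ile1.
  rewrite /p mulN1r ger0_norm ?exprn_ge0 ?subr_ge0//; apply: exprn_ile1.
    by rewrite subr_ge0.
  by rewrite lerBlDr lerDl.
- move=> x; have /andP[y0 y1] := y01 x.
  have -> : (sin (x / N) < sin (c / N)) = (y x < 2^-1) by rewrite yE; apply/idP/idP; lra.
  by under eq_fun do rewrite /p mulN1r; exact: power_step_cvg.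
- by move=> n; have [] := multiplier_ergodic (mp n).
- by [].
Qed.

(** As N grows, x / N and c / N enter the interval on which the sine is
    increasing, so that the two inequalities become equivalent. *)
Lemma ergodic_half_line (c : R) : ergodic (fun x => (x < c)%R%:R).
Proof.
have [| | | |_ //] := @ergodic_lim _ _ _ _ _ xi_meas _ xi_law
  (fun x => (x < c)%R%:R) (fun n x => (sin (x / n.+1%:R) < sin (c / n.+1%:R))%R%:R) 1.
- move=> n.
  have mlt : measurable_fun [set: R] (fun x : R => sin (x / n.+1%:R) < sin (c / n.+1%:R)).
    apply: measurable_fun_ltr => //.
    apply: continuous_measurable_fun => x; apply: continuous_comp; last exact: continuous_sin.
    by apply: cvgM; [exact: cvg_id|exact: cvg_cst].
  apply: (measurableT_comp (f := fun b : bool => b%:R : R)) mlt => //.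
- by move=> n x; case: (_ < _); rewrite ?normr1 ?normr0.
- move=> x; apply: cvg_near_cst; near=> n.
  have n0 : (0 : R) < n.+1%:R by rewrite ltr0n.
  have inI (z : R) : `|z| <= n.+1%:R -> z / n.+1%:R \in `[(- (pi / 2)), (pi / 2)].
    move=> zn; rewrite in_itv/= -ler_norml normrM (ger0_norm (_ : 0 <= n.+1%:R^-1)) ?invr_ge0//.
    rewrite (@le_trans _ _ 1)//; first by rewrite ler_pdivrMr// mul1r.
    by have := @pi_ge2 R; lra.
  rewrite ltr_sin ?inI// ?ltr_pM2r ?invr_gt0//.
  + near: n; exists (Num.truncn `|x|).+1 => // n /= xn.
    by rewrite (le_trans (ltW (truncnS_gt _)))// ler_nat leqW.
  + near: n; exists (Num.truncn `|c|).+1 => // n /= xn.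
    by rewrite (le_trans (ltW (truncnS_gt _)))// ler_nat leqW.
- by move=> n; exact: half_line_sin.
Unshelve. all: by end_near. Qed.

End density.

Section law_of_large_numbers.
Context d (Omega : measurableType d) (R : realType) (P : probability Omega R).
Variable xi : R -> Omega -> R.
Hypothesis xi_meas : measurable_process xi.
Variable nu : probability (measurableTypeR R) R.
Hypothesis xi_law : forall t (A : set R), measurable A -> P (xi t @^-1` A) = nu A.
Hypothesis erg_half_line : forall c : R, ergodic P xi nu (fun x => (x < c)%R%:R).
Notation ergodic := (ergodic P xi nu).

Import HBSimple.

Let indic_bounded (A : set R) : measurable A -> bounded_measurable (\1_A : R -> R).
Proof.
move=> mA; split; first exact: measurable_indic.
by exists 1 => x; rewrite indicE; case: (_ \in _); rewrite ?normr1 ?normr0.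
Qed.

(** The half-lines form a pi-system that generates the Borel sets, and the sets
    with an ergodic indicator form a Dynkin class. *)
Lemma ergodic_indic (A : set R) : measurable A -> ergodic (\1_A).
Proof.
move=> mA.
have mE : @measurable _ (measurableTypeR R) = <<s RGenInftyO.G (R := R) >>.
  exact: RGenInftyO.measurableE.
have sA : <<s RGenInftyO.G (R := R) >> A by rewrite -mE.
pose EB (B : set R) := ergodic (\1_B).
refine (@dynkin_induction _ (measurableTypeR R) (RGenInftyO.G (R := R)) EB
  mE _ _ _ _ _ A sA); rewrite /EB {A mA sA mE EB}.
- move=> _ _ [x ->] [y ->]; exists (Num.min x y).
  apply/seteqP; split => z /=; rewrite !in_itv/= lt_min.
    by move=> [-> ->].
  by move=> /andP[].
- by rewrite indicT; exact: ergodic_cst.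
- move=> _ [x ->].
  rewrite (_ : \1_ _ = (fun y => (y < x)%R%:R)); first exact: erg_half_line.
  by apply/funext => y; rewrite indicE mem_setE/= in_itv.
- move=> S mS eS.
  rewrite (_ : \1_ _ = (fun x => 1 + (-1) * \1_S x)).
    apply: (ergodicD xi_meas).
    + exact: bounded_measurable_cst.
    + by apply: bounded_measurableM; [exact: bounded_measurable_cst|exact: indic_bounded].
    + exact: ergodic_cst.
    + by apply: (ergodicZ xi_meas) => //; exact: indic_bounded.
  by apply/funext => x; rewrite !indicE in_setC; case: (_ \in _) => /=; ring.
- move=> F mF tF eF.
  pose U n := \bigcup_(i < n) F i.
  have mU n : measurable (U n) by apply: bigcup_measurable.
  have US n x : x \in U n.+1 = (x \in U n) || (x \in F n).
    apply/idP/idP.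
      rewrite inE => -[k /= kn Fk]; move: kn; rewrite ltnS leq_eqVlt => /orP[/eqP kn|kn].
        by apply/orP; right; rewrite inE -kn.
      by apply/orP; left; rewrite inE; exists k.
    move=> /orP[|]; rewrite !inE.
      by move=> [k /= kn Fk]; exists k => //=; exact: ltnW.
    by move=> Fn; exists n => /=.
  have disj n x : (x \in U n) -> (x \in F n) -> False.
    rewrite !inE => -[k /= kn Fk] Fn.
    have := tF k n I I; rewrite -/(_ k n) => h.
    by have := h (ex_intro _ x (conj Fk Fn)) => kE; rewrite kE ltnn in kn.
  have eU n : ergodic (\1_(U n)).
    elim: n => [|n IH].
      rewrite (_ : \1_ _ = cst 0); first exact: ergodic_cst.
      by apply/funext => x; rewrite indicE /U bigcup_mkord big_ord0 in_set0.
    rewrite (_ : \1_ _ = (fun x => \1_(U n) x + \1_(F n) x)).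
      exact: (ergodicD xi_meas (indic_bounded (mU n)) (indic_bounded (mF n)) IH (eF n)).
    apply/funext => x; rewrite !indicE US.
    case: (boolP (x \in U n)) => xU; case: (boolP (x \in F n)) => xF //=; rewrite ?addr0 ?add0r//.
    by have := disj n x xU xF.
  have [| | | |_ eUF] := @ergodic_lim _ _ _ _ _ xi_meas _ xi_law
    (\1_(\bigcup_k F k)) (fun n => \1_(U n)) 1.
  + by move=> n; apply: measurable_indic; exact: mU.
  + by move=> n x; rewrite indicE; case: (_ \in _); rewrite ?normr1 ?normr0.
  + move=> x; apply: cvg_near_cst; have [xF|xF] := boolP (x \in \bigcup_k F k).
      have := xF; rewrite inE => -[k _ Fk].
      exists k.+1 => // n /= kn; rewrite !indicE xF mem_set//.
      by exists k.
    apply: nearW => n; rewrite !indicE (negbTE xF) memNset// => -[k _ Fk].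
    by move: xF; rewrite notin_setE; apply; exists k.
  + exact: eU.
  + exact: eUF.
Qed.

(** Simple functions are linear combinations of indicators and are dense in
    L1(nu). *)
Lemma ergodic_integrable (f : R -> R) : nu.-integrable setT (EFin \o f) -> ergodic f.
Proof.
move=> intf; apply: (ergodic_approx xi_meas xi_law) => // e e0.
have [g [gint _ g0]] := approximation_sfun_integrable measurableT intf.
move/fine_cvgP : g0 => [fin0 /cvgr0Pnorm_le /(_ _ e0) le0].
near \oo => n.
have bsf (k : {sfun measurableTypeR R >-> R}) : bounded_measurable k /\ ergodic k.
  have step (s : seq R) : bounded_measurable (fun x => \sum_(y <- s) y * \1_(k @^-1` [set y]) x) /\
      ergodic (fun x => \sum_(y <- s) y * \1_(k @^-1` [set y]) x).
    elim: s => [|y s [bs es]].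
      rewrite (_ : (fun x => _) = cst 0); last by apply/funext => x; rewrite big_nil.
      by split; [exact: bounded_measurable_cst|exact: ergodic_cst].
    under eq_fun do rewrite big_cons.
    have mk : measurable (k @^-1` [set y] : set R) by exact: (measurable_sfunP k (measurable_set1 y)).
    have bk := bounded_measurableM (bounded_measurable_cst y) (indic_bounded mk).
    split; first exact: bounded_measurableD.
    exact: (ergodicD xi_meas bk bs
      (ergodicZ xi_meas y (indic_bounded mk) (ergodic_indic mk)) es).
  rewrite (_ : (k : R -> R) = (fun x =>
    \sum_(y <- finmap.enum_fset (fset_set (range k))) y * \1_(k @^-1` [set y]) x)) //.
  by apply/funext => x; rewrite fimfunE fsbig_finite.
have [bg eg] := bsf (g n).
exists (g n); split; [exact: bg.1|exact: bg.2|exact: eg|].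
have fi : (\int[nu]_x `|(f x)%:E - (g n x)%:E| \is a fin_num)%E by near: n; exact: fin0.
have : `|fine (\int[nu]_x `|(f x)%:E - (g n x)%:E|)%E| <= e by near: n; exact: le0.
rewrite ger0_norm; last by rewrite fine_ge0// integral_ge0.
by rewrite -lee_fin fineK.
Unshelve. all: by end_near. Qed.

End law_of_large_numbers.

(** * The Gaussian process *)

Section covariance_decay.
Context (R : realType).

(** The factor (1 + t^2)^(alpha j / 2) exceeds 1 / e once |t| exceeds
    (1 / e)^(2 / alpha j), because t^2 + 1 >= |t|. *)
Lemma covariance_decay (kappa : nat) (D vark alpha : 'I_kappa.+1 -> R) :
  (forall j, 0 <= D j) -> \sum_(j < kappa.+1) D j = 1 -> (forall j, 0 < alpha j) ->
  forall e : R, 0 < e -> exists A : R, forall t, A < `|t| ->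
    `|\sum_(j < kappa.+1) D j * (cos (vark j * t) / (1 + t ^+ 2) `^ (alpha j / 2))| <= e.
Proof.
move=> D0 D1 a0 e e0.
pose A j := e^-1 `^ (alpha j / 2)^-1.
have A0 j : 0 <= A j by exact: powR_ge0.
exists (\sum_j A j) => t At.
have le1 j : (1 + t ^+ 2) `^ (alpha j / 2) >= e^-1.
  have aj : 0 < alpha j / 2 by rewrite divr_gt0.
  have -> : e^-1 = A j `^ (alpha j / 2).
    by rewrite /A -powRrM mulVf ?gt_eqF// powRr1// invr_ge0 ltW.
  apply: ge0_ler_powR; rewrite ?nnegrE ?A0 ?(ltW aj)//; first by rewrite addr_ge0// sqr_ge0.
  have Aj : A j <= `|t|.
    rewrite (le_trans _ (ltW At))// (bigD1 j)//= lerDl sumr_ge0//.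
  rewrite (le_trans Aj)// -(real_normK (num_real t)).
  by have := sqr_ge0 (`|t| - 1); rewrite sqrrB1; have := normr_ge0 t; lra.
apply: (@le_trans _ _ (\sum_j D j * e)); last by rewrite -mulr_suml D1 mul1r.
apply: (le_trans (ler_norm_sum _ _ _)); apply: ler_sum => j _.
have p0 : 0 < (1 + t ^+ 2) `^ (alpha j / 2).
  by rewrite (lt_le_trans _ (le1 j))// invr_gt0.
rewrite normrM (ger0_norm (D0 j)) ler_wpM2l// normrM normfV (gtr0_norm p0).
rewrite ler_pdivrMr// (@le_trans _ _ 1)//.
  by rewrite ler_norml cos_geN1 cos_le1.
by rewrite -ler_pdivrMl// mulr1.
Qed.

End covariance_decay.

Section gaussian_process_lln.
Context d (Omega : measurableType d) (R : realType) (P : probability Omega R).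
Variable xi : R -> Omega -> R.
Hypothesis xi_meas : measurable_process xi.
Hypothesis xi_stat : stationary P xi.
Hypothesis xi_gauss : gaussian_process P xi.
Hypothesis xi_mean : forall t, ('E_P[xi t] = 0)%E.
Hypothesis xi_var : forall t, 'E_P[fun w => (xi t w ^+ 2)%R]%E = 1%E.
Variable B : R -> R.
Hypothesis xi_cov : forall t, 'E_P[fun w => (xi 0 w * xi t w)%R]%E = (B t)%:E.
Hypothesis B_cvg0 : forall e : R, 0 < e -> exists A : R, forall t, A < `|t| -> `|B t| <= e.

Let mxi t : measurable_fun setT (xi t).
Proof. exact: (section_measurable xi_meas t (@measurable_id _ _ setT)). Qed.

Let xi0 : {mfun Omega >-> measurableTypeR R} :=
  HB.pack (xi 0 : Omega -> measurableTypeR R)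
    (isMeasurableFun.Build _ _ _ _ (xi 0 : Omega -> measurableTypeR R) (mxi 0)).

Definition marginal_law : probability (measurableTypeR R) R :=
  [the probability _ _ of distribution P xi0].

Lemma marginal_lawE t (A : set R) : measurable A -> P (xi t @^-1` A) = marginal_law A.
Proof.
move=> mA; pose A' : set (1.-tuple R) := (fun x => tnth x ord0) @^-1` A.
have mA' : measurable A'.
  by rewrite -[A']setTI; apply: (measurable_tnth ord0).
have := xi_stat (fun _ : 'I_1 => 0) t mA'.
rewrite /marginal_law /= /distribution /pushforward /=.
have fE (s : 'I_1 -> R) : fidi xi s @^-1` A' = xi (s ord0) @^-1` A.
  by apply/seteqP; split => w /=; rewrite /A' /= tnth_mktuple.
by rewrite !fE add0r.
Qed.

Let isq t : P.-integrable setT (fun w => (xi t w ^+ 2)%:E).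
Proof.
apply/integrableP; split.
  by apply/measurable_EFinP; exact: measurable_funX.
under eq_integral do rewrite gee0_abs ?lee_fin ?sqr_ge0//.
by have := xi_var t; rewrite expectation.unlock => ->; exact: ltry.
Qed.

Let imul s t : P.-integrable setT (fun w => (xi s w * xi t w)%:E).
Proof.
have i2 : P.-integrable setT (fun w => (xi s w ^+ 2 + xi t w ^+ 2)%:E).
  by under eq_fun do rewrite EFinD; exact: integrableD.
apply: (le_integrable measurableT _ _ i2) => [|w _].
  by apply/measurable_EFinP; exact: measurable_funM.
rewrite /= lee_fin [leRHS]ger0_norm ?addr_ge0 ?sqr_ge0//.
rewrite normrM -(real_normK (num_real (xi s w))) -(real_normK (num_real (xi t w))).
have := sqr_ge0 (`|xi s w| - `|xi t w|); have := mulr_ge0 (normr_ge0 (xi s w)) (normr_ge0 (xi t w)).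
rewrite sqrrB; lra.
Qed.

Let ixi t : P.-integrable setT (fun w => (xi t w)%:E).
Proof. exact: integrable_of_sq. Qed.

Let square_expand (c s t : R) : 
  (fun w => ((xi s w + c * xi t w) ^+ 2)%:E) =
  (fun w => (xi s w ^+ 2)%:E + ((2 * c)%:E * (xi s w * xi t w)%:E + (c ^+ 2)%:E * (xi t w ^+ 2)%:E))%E.
Proof. by apply/funext => w; rewrite -!EFinM -!EFinD; congr (_%:E); ring. Qed.

Let isq2 c s t : P.-integrable setT (fun w => ((xi s w + c * xi t w) ^+ 2)%:E).
Proof.
rewrite square_expand; apply: integrableD => //.
by apply: integrableD => //; exact: integrableZl.
Qed.

(** Strict stationarity, applied to the pair of times (0, t - s), reduces the
    covariance at (s, t) to the given one. *)
Let variance_combination (c s t : R) :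
  \int[P]_w ((xi s w + c * xi t w) ^+ 2) = 1 + (2 * c * B (t - s) + c ^+ 2).
Proof.
have shift : (\int[P]_w ((xi s w + c * xi t w) ^+ 2)%:E =
              \int[P]_w ((xi 0 w + c * xi (t - s) w) ^+ 2)%:E)%E.
  pose tt (i : 'I_2) : R := if i == ord0 then 0 else t - s.
  pose h (x : 2.-tuple R) : \bar R := ((tnth x ord0 + c * tnth x ord_max) ^+ 2)%:E.
  have mh : measurable_fun setT h.
    apply/measurable_EFinP; apply: measurable_funX; apply: measurable_funD.
      exact: measurable_tnth.
    by apply: measurable_funM => //; exact: measurable_tnth.
  have h0 x : (0 <= h x)%E by rewrite lee_fin sqr_ge0.
  have mfidi (u : 'I_2 -> R) : measurable_fun setT (fidi xi u).
    apply/measurable_fun_tnthP => i.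
    rewrite (_ : _ \o _ = xi (u i)); first exact: mxi.
    by apply/funext => w /=; rewrite tnth_mktuple.
  pose X u : {mfun Omega >-> 2.-tuple R} :=
    HB.pack (fidi xi u) (isMeasurableFun.Build _ _ _ _ _ (mfidi u)).
  have hE (u : 'I_2 -> R) : (\int[P]_w ((xi (u ord0) w + c * xi (u ord_max) w) ^+ 2)%:E =
      \int[distribution P (X u)]_x h x)%E.
    rewrite ge0_integral_distribution//; apply: eq_integral => w _.
    by rewrite /= /h !tnth_mktuple.
  have := hE (fun i => tt i + s); rewrite /tt /= add0r subrK => ->.
  have := hE tt; rewrite /tt /= => ->.
  by apply: eq_measure_integral => A mA _; exact: (xi_stat tt s mA).
rewrite /Rintegral shift square_expand integralD//; last first.
  by apply: integrableD => //; exact: integrableZl.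
rewrite integralD//; [|exact: integrableZl..].
rewrite !integralZl//.
have := xi_var 0; have := xi_var (t - s); have := xi_cov (t - s).
rewrite expectation.unlock => -> -> ->.
by rewrite mule1 -EFinM -!EFinD.
Qed.

Let gaussian_combination (c s t : R) : gaussian_rv P (fun w => xi s w + c * xi t w).
Proof.
have := xi_gauss (fun i : 'I_2 => if i == ord0 then s else t)
  (fun i : 'I_2 => if i == ord0 then 1 else c).
by under eq_fun do rewrite !big_ord_recl big_ord0 /= mul1r addr0.
Qed.

Let cos_combination (c s t a b : R) :
  \int[P]_w cos (a * (xi s w + c * xi t w) + b) =
  expR (- (a ^+ 2 * (1 + (2 * c * B (t - s) + c ^+ 2)) / 2)) * cos b.
Proof.
have mW : measurable_fun setT (fun w => xi s w + c * xi t w).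
  by apply: measurable_funD => //; exact: measurable_funM.
apply: (gaussian_cos a b mW (gaussian_combination c s t) (isq2 c s t) _
  (variance_combination c s t)).
rewrite RintegralD//; [|exact: ixi|rewrite /comp; under eq_fun do rewrite EFinM; exact: integrableZl].
rewrite (RintegralZl _ measurableT (ixi t)); have := xi_mean s; have := xi_mean t.
by rewrite expectation.unlock /Rintegral => -> -> /=; rewrite mulr0 addr0.
Qed.

Lemma gaussian_ergodic_cos (a b : R) :
  ergodic P xi marginal_law (fun x => cos (a * x + b)).
Proof.
apply: (ergodic_cos (beta := fun u => B (- u)) xi_meas marginal_lawE).
- move=> e /B_cvg0[A HA]; exists A => t At; by apply: HA; rewrite normrN.
- move=> t a' b'; have := cos_combination 0 t t a' b'.
  under eq_Rintegral do rewrite mul0r addr0.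
  by rewrite mulr0 mul0r expr0n !addr0 mulr1.
- move=> s t a' b'; have := cos_combination 1 s t a' b'.
  under eq_Rintegral do rewrite mul1r.
  by move=> ->; congr (expR (- _) * _); rewrite opprB; field.
- move=> s t a' b'; have := cos_combination (-1) s t a' b'.
  under eq_Rintegral do rewrite mulN1r.
  by move=> ->; congr (expR (- _) * _); rewrite opprB; field.
Qed.

(** The covariance of two cosines involves only the laws of the sum and of the
    difference of two values of the process, which are Gaussian by definition of
    the process. *)
Lemma gaussian_ergodic (f : R -> R) : marginal_law.-integrable setT (EFin \o f) ->
  ergodic P xi marginal_law f.
Proof.
apply: (ergodic_integrable xi_meas marginal_lawE) => c.
exact: (ergodic_half_line xi_meas marginal_lawE gaussian_ergodic_cos).
Qed.

End gaussian_process_lln.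

(** * Differential calculus along segments *)

Section gradients.
Context {R : realType} {q : nat}.
Implicit Types (u x y : 'rV[R]_q) (D : set 'rV[R]_q) (f : 'rV[R]_q -> R).

Lemma enormZ (c : R) u : enorm (c *: u) = `|c| * enorm u.
Proof.
rewrite /enorm; under eq_bigr do rewrite mxE exprMn.
by rewrite -mulr_sumr sqrtrM ?sqr_ge0// sqrtr_sqr.
Qed.

Lemma coord_le_enorm u i : `|u 0 i| <= enorm u.
Proof.
rewrite -sqrtr_sqr ler_wsqrtr// (bigD1 i)//= lerDl sumr_ge0// => j _.
exact: sqr_ge0.
Qed.

Lemma enorm_le_sum u : enorm u <= \sum_i `|u 0 i|.
Proof.
have s0 : 0 <= \sum_i `|u 0 i| by exact: sumr_ge0.
rewrite -(ler_pXn2r (_ : 0 < 2)%N) ?nnegrE ?sqrtr_ge0//.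
rewrite sqr_sqrtr; last by apply: sumr_ge0 => i _; exact: sqr_ge0.
rewrite [leRHS]expr2 mulr_suml; apply: ler_sum => i _.
rewrite -(real_normK (num_real (u 0 i))) expr2 ler_wpM2l// (bigD1 i)//= lerDl.
exact: sumr_ge0.
Qed.

Lemma is_derive_of_gradient D f x (e : 'rV[R]_q) (v : 'I_q -> R) :
  nbhs x D -> has_gradient_within D f x v ->
  is_derive x e f (\sum_i v i * e 0 i).
Proof.
move=> xD gf.
have lim : h^-1 *: ((f \o shift x) (h *: e) - f x) @[h --> 0^'] --> \sum_i v i * e 0 i.
  apply/cvgrPdist_le => eps eps0.
  have e1 : 0 < enorm e + 1 by rewrite ltr_wpDl// sqrtr_ge0.
  have := gf _ (divr_gt0 eps0 e1); rewrite near_withinE => gfx.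
  have c0 : h *: e + x @[h --> (0 : R)] --> x.
    rewrite -[X in _ --> X]add0r -[in X in _ --> X](scale0r e).
    by apply: cvgD; [apply: cvgZr_tmp; exact: cvg_id|exact: cvg_cst].
  have near_line : \forall h \near (0 : R), D (h *: e + x) ->
     `|f (h *: e + x) - f x - \sum_(i < q) v i * ((h *: e + x) 0 i - x 0 i)|
       <= eps / (enorm e + 1) * enorm (h *: e + x - x).
    exact: (c0 _ gfx).
  have nearD : \forall h \near (0 : R), D (h *: e + x) by exact: (c0 _ xD).
  near=> h.
  have h0 : h != 0 by near: h; exact: nbhs_dnbhs_neq.
  have Dh : D (h *: e + x) by near: h; exact: (nbhs_dnbhs nearD).
  have : D (h *: e + x) ->
     `|f (h *: e + x) - f x - \sum_(i < q) v i * ((h *: e + x) 0 i - x 0 i)|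
       <= eps / (enorm e + 1) * enorm (h *: e + x - x).
    by near: h; exact: (nbhs_dnbhs near_line).
  move=> /(_ Dh); rewrite addrK enormZ.
  have -> : \sum_(i < q) v i * ((h *: e + x) 0 i - x 0 i) = h * \sum_(i < q) v i * e 0 i.
    rewrite mulr_sumr; apply: eq_bigr => i _; rewrite !mxE; ring.
  move=> bnd; rewrite /= distrC.
  have -> : h^-1 *: (f (h *: e + x) - f x) - \sum_i v i * e 0 i =
            h^-1 * (f (h *: e + x) - f x - h * \sum_i v i * e 0 i).
    by rewrite /GRing.scale/=; field.
  rewrite normrM normfV ler_pdivrMl ?normr_gt0// (le_trans bnd)//.
  rewrite [leLHS]mulrCA ler_wpM2l// -mulrA ler_piMr ?(ltW eps0)//.
  by rewrite ler_pdivrMl// mulr1 lerDl.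
by apply: DeriveDef; [apply/cvg_ex; eexists; exact: lim|exact: cvg_lim].
Unshelve. all: by end_near. Qed.

(** The mean value theorem for the restriction of f to the segment, whose
    derivative is given by the gradient. *)
Lemma gradient_MVT D f (v : 'I_q -> 'rV[R]_q -> R) x y :
  (forall s : R, 0 <= s <= 1 -> nbhs (x + s *: (y - x)) D) ->
  (forall z, D z -> has_gradient_within D f z (v ^~ z)) ->
  exists2 s : R, 0 <= s <= 1 &
    f y - f x = \sum_i v i (x + s *: (y - x)) * (y 0 i - x 0 i).
Proof.
move=> segD gf; pose phi (s : R) := f (x + s *: (y - x)).
pose dphi (s : R) := \sum_i v i (x + s *: (y - x)) * (y - x) 0 i.
have dphiE (s : R) : 0 <= s <= 1 -> is_derive s (1 : R) phi (dphi s).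
  move=> s01; have nD := segD s s01.
  have [df dE] := is_derive_of_gradient (y - x) nD (gf _ (nbhs_singleton nD)).
  have qE : (fun h : R => h^-1 *: ((phi \o shift s) (h *: 1) - phi s)) =
     (fun h : R => h^-1 *: ((f \o shift (x + s *: (y - x))) (h *: (y - x)) - f (x + s *: (y - x)))).
    apply/funext => h; congr (_ *: (_ - _)).
    rewrite /phi /=; congr f; rewrite [h *: 1]mulr1 scalerDl addrCA; congr (_ + _).
  by apply: DeriveDef; rewrite /derivable /derive qE.
have [||c] := @MVT R phi dphi 0 1 ltr01.
- by move=> s; rewrite in_itv/= => /andP[s0 s1]; apply: dphiE; rewrite !ltW.
- apply: derivable_within_continuous => s; rewrite in_itv/= => s01.
  by have [] := dphiE s s01.
rewrite in_itv/= => /andP[c0 c1]; rewrite /phi scale1r scale0r addr0 subrKC => E.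
exists c; first by rewrite !ltW.
by rewrite E subr0 mulr1; apply: eq_bigr => i _; rewrite !mxE.
Qed.

End gradients.

Section smooth_regression.
Context {R : realType} {q : nat} (g : R -> 'rV[R]_q -> R).
Variable Theta : set 'rV[R]_q.
Hypothesis Theta_open : open Theta.
Hypothesis g_cont : {within [set: R] `*` closure Theta,
   continuous (fun p : R * 'rV[R]_q => g p.1 p.2)}.
Hypothesis g_diff : forall t, twice_differentiable_on (closure Theta) (g t).

Let sum_delta (v : 'I_q -> R) (i : 'I_q) : \sum_j v j * (delta_mx 0 i : 'rV[R]_q) 0 j = v i.
Proof.
rewrite (bigD1 i)//= mxE !eqxx mulr1 big1 ?addr0// => j ji.
by rewrite mxE (negbTE ji) andbF mulr0.
Qed.

Lemma gradient_partial D (f : 'rV[R]_q -> R) x (v : 'I_q -> R) i :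
  nbhs x D -> has_gradient_within D f x v -> partial i f x = v i.
Proof.
move=> xD gf; have dv := is_derive_of_gradient (delta_mx 0 i) xD gf.
by rewrite /partial derive_val sum_delta.
Qed.

Let nbhs_Theta x : Theta x -> nbhs x Theta.
Proof. by move=> xT; exact: open_nbhs_nbhs. Qed.

Let nbhs_closure x : Theta x -> nbhs x (closure Theta).
Proof. by move=> /nbhs_Theta; apply: filterS; exact: subset_closure. Qed.

(** On the open set Theta the derivatives provided by the hypothesis are
    directional derivatives along the axes. As they agree with g1 on a
    neighbourhood, the second derivatives can be identified in turn. *)
Lemma regression_gradients t x : Theta x ->
  has_gradient_within Theta (g t) x (fun i => g1 g i t x) /\
  forall i, has_gradient_within Theta (g1 g i t) x (fun l => g2 g i l t x).
Proof.
have [v [w vw]] := g_diff t.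
have vE z i : Theta z -> g1 g i t z = v i z.
  move=> zT; have [gz _] := vw _ (subset_closure zT).
  by rewrite /g1 (gradient_partial i (nbhs_closure zT) gz).
have shrink f (z : 'rV[R]_q) a : has_gradient_within (closure Theta) f z a ->
    has_gradient_within Theta f z a.
  move=> h e e0; have := h e e0; rewrite !near_withinE; apply: filterS => y hy yT.
  by apply: hy; exact: subset_closure.
have gv z i : Theta z -> has_gradient_within Theta (g1 g i t) z (fun l => w i l z).
  move=> zT; have [_ /(_ i) /shrink h] := vw _ (subset_closure zT).
  move=> e e0; have := h e e0; rewrite !near_withinE; apply: filterS => y hy yT.
  by rewrite !vE//; exact: hy.
have wE z i l : Theta z -> g2 g i l t z = w i l z.
  by move=> zT; rewrite /g2 (gradient_partial l (nbhs_Theta zT) (gv z i zT)).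
move=> xT; split.
  have [gx _] := vw _ (subset_closure xT).
  by under [X in has_gradient_within _ _ _ X]eq_fun do rewrite (vE x)//; exact: shrink.
by move=> i; under [X in has_gradient_within _ _ _ X]eq_fun do rewrite (wE x)//; exact: gv.
Qed.

Lemma regression_measurable x : Theta x -> measurable_fun [set: R] (fun t => g t x).
Proof.
move=> xT; apply: continuous_measurable_fun => t0.
have /subspace_continuousP/(_ (t0, x)) := g_cont.
move=> /(_ (conj I (subset_closure xT))) /= ct.
apply: (@cvg_comp _ _ _ (fun t : R => (t, x)) (fun p : R * 'rV[R]_q => g p.1 p.2) _ _ _ _ ct).
move=> A; rewrite /= nbhs_simpl /within /= => nA.
have c : (t, x) @[t --> t0] --> (t0, x).
  have h1 : t @[t --> t0] --> t0 by exact: cvg_id.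
  have h2 : (fun=> x) t @[t --> t0] --> x by exact: cvg_cst.
  exact: (cvg_pair h1 h2).
have nt : nbhs t0 (fun t => ([set: R] `*` closure Theta) (t, x) -> A (t, x)) by exact: (c _ nA).
apply: filterS nt => t hA; apply: hA; split => //=; exact: (subset_closure xT).
Qed.

(** A partial derivative is a pointwise limit of difference quotients, which are
    continuous in t. *)
Lemma partial_measurable i x : Theta x -> measurable_fun [set: R] (fun t => g1 g i t x).
Proof.
move=> xT; pose e : 'rV[R]_q := delta_mx 0 i.
have c0 : h *: e + x @[h --> (0 : R)] --> x.
  rewrite -[X in _ --> X]add0r -[in X in _ --> X](scale0r e).
  by apply: cvgD; [apply: cvgZr_tmp; exact: cvg_id|exact: cvg_cst].
have [r /= r0 rT] : \forall h \near (0 : R), Theta (h *: e + x) by exact: (c0 _ (nbhs_Theta xT)).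
pose n0 := (Num.truncn r^-1).+1.
pose s n : R := (n0 + n).+1%:R^-1.
have s0 n : 0 < s n by rewrite invr_gt0.
have sT n : Theta (s n *: e + x).
  apply: rT; rewrite /= sub0r normrN gtr0_norm// /s invf_plt ?posrE//.
  rewrite (lt_le_trans (truncnS_gt _))// ler_nat -/n0 (leq_trans (leq_addr n n0))//.
have cs : s n @[n --> \oo] --> 0^'.
  apply: (@cvg_trans _ (within [set y : R | y != 0] (nbhs (0 : R)))) => //.
  move=> A; rewrite /within /= => nA.
  have cs0 : s n @[n --> \oo] --> (0 : R).
    have := @cvg_harmonic R; rewrite -(cvg_shiftn n0) /harmonic.
    by under eq_fun do rewrite addnC.
  have nn : \forall n \near \oo, [set y : R | y != 0] (s n) -> A (s n) by exact: (cs0 _ nA).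
  by apply: filterS nn => n /=; apply; rewrite gt_eqF.
pose hn (n : nat) (t : R) : R := (s n)^-1 * (g t (s n *: e + x) - g t x).
refine (measurable_fun_cvg (h := hn) _ _).
- move=> n; apply: measurable_funM => //.
  by apply: measurable_funB; [exact: (regression_measurable (sT n))|exact: (regression_measurable xT)].
- move=> t _; have [gx _] := regression_gradients t xT.
  have [dg dE] := is_derive_of_gradient e (nbhs_Theta xT) gx.
  rewrite -[g1 g i t x](sum_delta (fun j => g1 g j t x)) -dE /derive.
  exact: (cvg_comp _ _ cs dg).
Qed.

Lemma regression_MVT t x y :
  (forall s : R, 0 <= s <= 1 -> Theta (x + s *: (y - x))) ->
  (exists2 s : R, 0 <= s <= 1 &
    g t y - g t x = \sum_i g1 g i t (x + s *: (y - x)) * (y 0 i - x 0 i)) /\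
  forall i, exists2 s : R, 0 <= s <= 1 &
    g1 g i t y - g1 g i t x = \sum_l g2 g i l t (x + s *: (y - x)) * (y 0 l - x 0 l).
Proof.
move=> seg; split=> [|i].
  apply: (@gradient_MVT _ _ Theta (g t) (fun i => g1 g i t)) => [s s01|z zT].
    by apply: nbhs_Theta; exact: seg.
  exact: (regression_gradients t zT).1.
apply: (@gradient_MVT _ _ Theta (g1 g i t) (fun l => g2 g i l t)) => [s s01|z zT].
  by apply: nbhs_Theta; exact: seg.
exact: (regression_gradients t zT).2.
Qed.

End smooth_regression.

(** * The normalized regression function *)

Section normalized_regression.
Context {R : realType} {q : nat} (g : R -> 'rV[R]_q -> R).
Variables (Theta : set 'rV[R]_q) (theta : 'rV[R]_q).
Hypothesis Theta_open : open Theta.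
Hypothesis theta_in : Theta theta.
Hypothesis d_liminf : forall i : 'I_q,
  (0 < limf_einf (fun T : R => (T^-1 * d1 g theta T i ^+ 2)%:E) (pinfty_nbhs R))%E.

(** The sup-norm ball. It replaces the Euclidean one because it is obviously
    convex and has an explicit finite net. *)
Definition box (rho : R) : set 'rV[R]_q := [set u | forall i, `|u 0 i| <= rho].

Lemma eball_box rho u : eball rho u -> box rho u.
Proof. by move=> h i; exact: le_trans (coord_le_enorm u i) h. Qed.

Lemma box_eball rho u : box rho u -> eball (q%:R * rho) u.
Proof.
move=> h; rewrite /eball /= (le_trans (enorm_le_sum u))//.
apply: (@le_trans _ _ (\sum_(i < q) rho)); first by apply: ler_sum => i _; exact: h.
by rewrite sumr_const card_ord mulr_natl.
Qed.

Lemma box_segment rho u v (s : R) : 0 <= s <= 1 -> box rho u -> box rho v ->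
  box rho (u + s *: (v - u)).
Proof.
move=> /andP[s0 s1] bu bv i; rewrite !mxE.
have -> : u 0 i + s * (v 0 i - u 0 i) = (1 - s) * u 0 i + s * v 0 i by ring.
rewrite (le_trans (ler_normD _ _))// !normrM (ger0_norm s0) ger0_norm ?subr_ge0//.
have -> : rho = (1 - s) * rho + s * rho by ring.
by rewrite lerD// ler_wpM2l ?subr_ge0.
Qed.

Lemma near_le_sqrt (A : R) : \forall T \near +oo, A <= Num.sqrt T.
Proof.
apply: filterS (nbhs_pinfty_ge (num_real (A ^+ 2))) => T AT.
by rewrite (le_trans (ler_norm A))// -sqrtr_sqr ler_wsqrtr.
Qed.

Lemma near_d1_ge : exists2 c : R, 0 < c &
  \forall T \near +oo, forall i, c * Num.sqrt T <= d1 g theta T i.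
Proof.
have di i : exists c : R, 0 < c /\ \forall T \near +oo, c * Num.sqrt T <= d1 g theta T i.
  have := d_liminf i; rewrite limf_einfE => /ereal_sup_gt[_ [V VF <-] infV].
  have [c c0 cinf] : exists2 c : R, 0 < c &
      (c%:E <= ereal_inf [set (x^-1 * d1 g theta x i ^+ 2)%:E | x in V])%E.
    case: (ereal_inf _) infV => [r|_|//]; last by exists 1 => //; exact: leey.
    by rewrite lte_fin => r0; exists r.
  exists (Num.sqrt c); split; first by rewrite sqrtr_gt0.
  apply: filterS2 VF (nbhs_pinfty_gt (num_real 0)) => T VT T0.
  rewrite -sqrtrM ?(ltW c0)// -(@ger0_norm _ (d1 g theta T i)) ?sqrtr_ge0//.
  rewrite -sqrtr_sqr ler_wsqrtr// -ler_pdivlMr// mulrC -lee_fin.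
  by rewrite (le_trans cinf)//; apply: ereal_inf_lbound; exists T.
have [c Hc] := choice di.
exists (\big[Num.min/1]_i c i).
  by apply/bigmin_gtP; split => // i _; have [] := Hc i.
have : \forall T \near +oo, forall i, c i * Num.sqrt T <= d1 g theta T i.
  by apply: filter_forall => i; have [] := Hc i.
apply: filterS => T h i; rewrite (le_trans _ (h i))// ler_wpM2r ?sqrtr_ge0//.
exact: bigmin_le_cond.
Qed.

Lemma near_d1_gt0 : \forall T \near +oo, forall i, 0 < d1 g theta T i.
Proof.
have [c c0 Hc] := near_d1_ge.
apply: filterS2 Hc (nbhs_pinfty_gt (num_real 0)) => T h T0 i.
by rewrite (lt_le_trans _ (h i))// mulr_gt0// sqrtr_gt0.
Qed.

(** The scales d1 grow at least like sqrt T, so that local parameters converge to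
    theta, uniformly on the box. *)
Lemma near_local_param (rho : R) :
  \forall T \near +oo, forall u, box rho u -> Theta (local_param g theta T u).
Proof.
have /nbhs_ballP[e /= e0 sub] : nbhs theta Theta by exact: open_nbhs_nbhs.
have [c c0 Hc] := near_d1_ge.
apply: filterS3 Hc (near_le_sqrt ((`|rho| + 1) / (c * e))) (nbhs_pinfty_gt (num_real 0)) => T h sT T0 u bu.
apply: sub; split => // i j; rewrite /ball/= (ord1 i) !mxE opprD addNKr normrN.
have s0 : 0 < Num.sqrt T by rewrite sqrtr_gt0.
have d0 : 0 < d1 g theta T j by rewrite (lt_le_trans _ (h j))// mulr_gt0.
rewrite normrM normfV (gtr0_norm d0) ltr_pdivrMr//.
apply: (@lt_le_trans _ _ (`|rho| + 1)).
  by rewrite (le_lt_trans (bu j))// (le_lt_trans (ler_norm _))// ltrDl.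
rewrite ler_pdivrMr ?mulr_gt0// in sT.
apply: (le_trans sT); rewrite (_ : _ * (c * e) = e * (c * Num.sqrt T)); last by ring.
by rewrite ler_wpM2l ?(ltW e0)//; exact: h.
Qed.

Lemma local_param0 T : local_param g theta T 0 = theta.
Proof. by apply/rowP => i; rewrite !mxE mul0r addr0. Qed.

Lemma local_param_segment T (u v : 'rV[R]_q) (s : R) :
  local_param g theta T u + s *: (local_param g theta T v - local_param g theta T u) =
  local_param g theta T (u + s *: (v - u)).
Proof. by apply/rowP => i; rewrite !mxE; ring. Qed.

End normalized_regression.

Section normalized_bounds.
Context {R : realType} {q : nat} (g : R -> 'rV[R]_q -> R).
Variables (Theta : set 'rV[R]_q) (theta : 'rV[R]_q).
Hypothesis Theta_open : open Theta.
Hypothesis theta_in : Theta theta.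
Hypothesis g_diff : forall t, twice_differentiable_on (closure Theta) (g t).
Hypothesis d_liminf : forall i : 'I_q,
  (0 < limf_einf (fun T : R => (T^-1 * d1 g theta T i ^+ 2)%:E) (pinfty_nbhs R))%E.
Hypothesis h_bound : forall r : R, 0 <= r ->
     exists (k1 : 'I_q -> R) (k2 k3 : 'I_q -> 'I_q -> R),
     [/\ forall i, 0 < k1 i, forall i l, 0 < k2 i l, forall i l, 0 < k3 i l &
     \forall T \near +oo, forall i l : 'I_q,
     [/\ forall t u, t \in `[0, T] -> eball r u ->
           `|h1 g theta T i t u| <= k1 i / Num.sqrt T * d1 g theta T i,
         forall t u, t \in `[0, T] -> eball r u ->
           `|h2 g theta T i l t u| <= k2 i l / Num.sqrt T * d2 g theta T i l &
         d2 g theta T i l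
           <= k3 i l / Num.sqrt T * (d1 g theta T i * d1 g theta T l)]].

(** The normalized score, that is, the weight of the noise in psi. *)
Definition nscore T i t (u : 'rV[R]_q) : R := h1 g theta T i t u / d1 g theta T i.

Let sqrtT_inv (T : R) : 0 < T -> (Num.sqrt T)^-1 * (Num.sqrt T)^-1 = T^-1.
Proof. by move=> T0; rewrite -invfM -expr2 sqr_sqrtr// ltW. Qed.

Let split_inv (a b c s T : R) : s * s = T^-1 -> a * b / T * c = a * s * (b * s * c).
Proof. by move=> <-; ring. Qed.

Let cancel_scale (a c e eta T : R) : e != 0 -> a / T * (c * e) * (eta / e) = a * eta / T * c.
Proof. by move=> e0; rewrite -[in RHS](divfK e0 eta); ring. Qed.

(** Each h1 / d1 is O(T^(-1/2)) by hypothesis. The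
    second derivatives satisfy |h2| <= k2 k3 d1 d1 / T, so by the mean value
    theorem the normalized score is Lipschitz in u with constant O(1/T), the
    factors d1 cancelling. Hence the first order Taylor remainder of h is O(1/T)
    as well. *)
Lemma near_nscore_bounds (rho : R) : 0 <= rho -> exists2 C : R, 0 < C &
  \forall T \near +oo, forall t (u v : 'rV[R]_q), t \in `[0, T] -> box rho u -> box rho v ->
  [/\ forall i, `|nscore T i t u| <= C / Num.sqrt T,
      forall i eta, (forall l, `|u 0 l - v 0 l| <= eta) ->
        `|nscore T i t u - nscore T i t v| <= C * eta / T &
      `|h g theta T t 0 - h g theta T t u + \sum_l nscore T l t 0 * u 0 l| <= C / T].
Proof.
move=> rho0.
have [|k1 [k2 [k3 [k1_gt0 k2_gt0 k3_gt0 Hk]]]] := h_bound (_ : 0 <= q%:R * rho).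
  by rewrite mulr_ge0.
pose K1 := \sum_i k1 i.
pose K2 := \sum_i \sum_l k2 i l * k3 i l.
have K1_ge0 : 0 <= K1 by apply: sumr_ge0 => i _; exact: ltW.
have k23 i l : 0 <= k2 i l * k3 i l by rewrite mulr_ge0 ?(ltW (k2_gt0 _ _))// ltW.
have K2_ge0 : 0 <= K2 by apply: sumr_ge0 => i _; apply: sumr_ge0 => l _.
have K3_ge0 : 0 <= 1 + q%:R * (K2 * rho * rho) by rewrite addr_ge0// !mulr_ge0.
(* K1, K2 and the last product serve the three bounds in this order; adding 1
   makes the constant positive *)
exists (K1 + K2 + (1 + q%:R * (K2 * rho * rho))).
  by rewrite ltr_wpDl ?addr_ge0// ltr_pwDl// !mulr_ge0.
have near_d := near_d1_gt0 d_liminf.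
have near_in := near_local_param Theta_open theta_in d_liminf rho.
near=> T => t u v tT bu bv.
have T0 : 0 < T by near: T; exact: nbhs_pinfty_gt.
have s0 : 0 < Num.sqrt T by rewrite sqrtr_gt0.
have d_gt0 i : 0 < d1 g theta T i by move: i; near: T; exact: near_d.
have inT z : box rho z -> Theta (local_param g theta T z) by move: z; near: T; exact: near_in.
have Hb i l : [/\ forall t u, t \in `[0, T] -> eball (q%:R * rho) u ->
           `|h1 g theta T i t u| <= k1 i / Num.sqrt T * d1 g theta T i,
         forall t u, t \in `[0, T] -> eball (q%:R * rho) u ->
           `|h2 g theta T i l t u| <= k2 i l / Num.sqrt T * d2 g theta T i l &
         d2 g theta T i l
           <= k3 i l / Num.sqrt T * (d1 g theta T i * d1 g theta T l)].
  by move: i l; near: T.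
have score_le i z : box rho z -> `|nscore T i t z| <= K1 / Num.sqrt T.
  move=> bz; have [h _ _] := Hb i i.
  rewrite /nscore normrM normfV (gtr0_norm (d_gt0 i)) ler_pdivrMr//.
  rewrite (le_trans (h t z tT (box_eball bz)))// ler_wpM2r ?(ltW (d_gt0 i))//.
  rewrite ler_wpM2r ?invr_ge0 ?(ltW s0)// /K1 (bigD1 i)//= lerDl sumr_ge0// => j _.
  exact: ltW.
have score_diff i a b eta : box rho a -> box rho b -> (forall l, `|a 0 l - b 0 l| <= eta) ->
    `|nscore T i t a - nscore T i t b| <= K2 * eta / T.
  move=> ba bb ab.
  have [|_ mvt] := @regression_MVT R q g Theta Theta_open g_diff t
    (local_param g theta T b) (local_param g theta T a).
    by move=> s s01; rewrite local_param_segment; apply: inT; exact: box_segment.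
  have [s s01] := mvt i; rewrite local_param_segment => E.
  have bs : box rho (b + s *: (a - b)) by exact: box_segment.
  rewrite /nscore -mulrBl /h1 E normrM normfV (gtr0_norm (d_gt0 i)) ler_pdivrMr//.
  apply: (le_trans (ler_norm_sum _ _ _)).
  apply: (@le_trans _ _ (\sum_l k2 i l * k3 i l * eta / T * d1 g theta T i)).
    apply: ler_sum => l _; rewrite normrM.
    have -> : local_param g theta T a 0 l - local_param g theta T b 0 l = (a 0 l - b 0 l) / d1 g theta T l.
      by rewrite !mxE; ring.
    have [_ h2le d2le] := Hb i l.
    have h2le' : `|g2 g i l t (local_param g theta T (b + s *: (a - b)))| <=
        k2 i l * k3 i l / T * (d1 g theta T i * d1 g theta T l).
      rewrite (split_inv _ _ _ (sqrtT_inv T0)) (le_trans (h2le t _ tT (box_eball bs)))//.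
      by rewrite ler_wpM2l// divr_ge0// ltW.
    rewrite normrM normfV (gtr0_norm (d_gt0 l)).
    apply: (le_trans (ler_pM _ _ h2le' (ler_wpM2r _ (ab l)))) => //.
      by rewrite divr_ge0// ltW.
      by rewrite invr_ge0 ltW.
    by rewrite cancel_scale// gt_eqF.
  have eta0 : 0 <= eta by exact: le_trans (normr_ge0 _) (ab i).
  rewrite -!mulr_suml ler_wpM2r ?(ltW (d_gt0 i))// ler_wpM2r ?invr_ge0 ?(ltW T0)//.
  rewrite ler_wpM2r// /K2 [leRHS](bigD1 i)//= lerDl sumr_ge0// => j _.
  by rewrite sumr_ge0.
split.
- move=> i; rewrite (le_trans (score_le i u bu))// ler_wpM2r ?invr_ge0 ?(ltW s0)//.
  by rewrite -addrA lerDl addr_ge0.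
- move=> i eta uv; rewrite (le_trans (score_diff i u v eta bu bv uv))//.
  have eta0 : 0 <= eta by exact: le_trans (normr_ge0 _) (uv i).
  rewrite ler_wpM2r ?invr_ge0 ?(ltW T0)// ler_wpM2r//.
  by rewrite [K1 + K2]addrC -addrA lerDl addr_ge0.
- have b0 : box rho (0 : 'rV[R]_q) by move=> i; rewrite mxE normr0.
  have [|[s s01 E] _] := @regression_MVT R q g Theta Theta_open g_diff t
    (local_param g theta T 0) (local_param g theta T u).
    by move=> s s01; rewrite local_param_segment; apply: inT; exact: box_segment.
  rewrite local_param_segment subr0 add0r in E.
  have bs : box rho (s *: u) by have := box_segment s01 b0 bu; rewrite subr0 add0r.
  have -> : h g theta T t 0 - h g theta T t u + \sum_l nscore T l t 0 * u 0 l =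
      \sum_l (nscore T l t 0 - nscore T l t (s *: u)) * u 0 l.
    rewrite /h -opprB E -sumrN -big_split/=; apply: eq_bigr => l _.
    by rewrite /nscore /h1 !mxE; ring.
  apply: (le_trans (ler_norm_sum _ _ _)).
  apply: (@le_trans _ _ (\sum_(l < q) K2 * rho / T * rho)).
    apply: ler_sum => l _; rewrite normrM; apply: ler_pM => //.
    apply: score_diff => // j; rewrite !mxE sub0r normrN.
    by have := bs j; rewrite !mxE.
  rewrite sumr_const card_ord -[leLHS]mulr_natl.
  rewrite (_ : q%:R * _ = q%:R * (K2 * rho * rho) / T); last by ring.
  by rewrite ler_wpM2r ?invr_ge0 ?(ltW T0)// addrA lerDr !addr_ge0.
Unshelve. all: by end_near. Qed.

End normalized_bounds.

(** * A pathwise bound *)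

(** A grid of step eta, clipped so that its points stay in the box; the point just
    below u is not affected by the clipping. *)
Lemma box_net (R : realType) (q : nat) (rho eta : R) : 0 <= rho -> 0 < eta ->
  exists s : seq 'rV[R]_q, (forall v, v \in s -> box rho v) /\
    forall u, box rho u -> exists2 v, v \in s & forall l, `|u 0 l - v 0 l| <= eta.
Proof.
move=> rho0 eta0; pose n := Num.truncn (2 * rho / eta).
pose pt (f : {ffun 'I_q -> 'I_n.+1}) : 'rV[R]_q :=
  \row_l Num.min rho (- rho + (f l)%:R * eta).
have nE0 : 0 <= 2 * rho / eta by rewrite divr_ge0 ?mulr_ge0// ltW.
exists (codom pt); split=> [v /codomP[f ->] l|u bu].
  rewrite mxE ler_norml ge_min lexx andbT le_min lerDl mulr_ge0 ?(ltW eta0)//.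
  by rewrite andbT; lra.
pose k l := Num.truncn ((u 0 l + rho) / eta).
have u_ge l : 0 <= u 0 l + rho by have := bu l; rewrite ler_norml => /andP[? ?]; lra.
have kn l : (k l < n.+1)%N.
  rewrite ltnS /k /n; apply: le_truncn; rewrite ler_wpM2r ?invr_ge0 ?(ltW eta0)//.
  by have := bu l; rewrite ler_norml => /andP[? ?]; lra.
exists (pt [ffun l => Ordinal (kn l)]); first exact: codom_f.
move=> l; rewrite mxE ffunE /=.
have /andP[kle klt] : (k l)%:R <= (u 0 l + rho) / eta < (k l).+1%:R.
  by apply: truncn_itv; rewrite divr_ge0// ltW.
have kle' : (k l)%:R * eta <= u 0 l + rho by rewrite -ler_pdivlMr.
have klt' : u 0 l + rho < (k l)%:R * eta + eta.
  by move: klt; rewrite ltr_pdivrMr// -natr1 mulrDl mul1r.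
have ule : u 0 l <= rho by have := bu l; rewrite ler_norml => /andP[].
have -> : Num.min rho (- rho + (k l)%:R * eta) = - rho + (k l)%:R * eta.
  by apply/min_idPr; lra.
by rewrite ler_norml; apply/andP; split; lra.
Qed.

Section path_bound.
Context {R : realType} {q : nat} (g : R -> 'rV[R]_q -> R).
Variables (Theta : set 'rV[R]_q) (theta : 'rV[R]_q).
Hypothesis Theta_open : open Theta.
Hypothesis g_cont : {within [set: R] `*` closure Theta,
   continuous (fun p : R * 'rV[R]_q => g p.1 p.2)}.
Hypothesis g_diff : forall t, twice_differentiable_on (closure Theta) (g t).
Variables (rho C T : R).
Hypotheses (rho_ge0 : 0 <= rho) (C_ge0 : 0 <= C) (T_gt0 : 0 < T).
Hypothesis in_Theta : forall u, box rho u -> Theta (local_param g theta T u).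
Notation Delta := (nscore g theta T).
Hypothesis bounds : forall t (u v : 'rV[R]_q), t \in `[0, T] -> box rho u -> box rho v ->
  [/\ forall i, `|Delta i t u| <= C / Num.sqrt T,
      forall i eta, (forall l, `|u 0 l - v 0 l| <= eta) ->
        `|Delta i t u - Delta i t v| <= C * eta / T &
      `|h g theta T t 0 - h g theta T t u + \sum_l Delta l t 0 * u 0 l| <= C / T].
Notation lam := (@lebesgue_measure R).
Notation I := (`[0, T]%classic : set R).

(** The constant C * rho + 1 bounds T times the variation of the score between v
    and 0; it is positive even if rho is 0. *)
Definition increment_weight i v : R -> R :=
  (fun t => (Delta i t v - Delta i t 0) / (C * rho + 1)) \_ I.

Let c1 : 0 < C * rho + 1.
Proof. by rewrite ltr_wpDl// mulr_ge0. Qed.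

Let box0 : box rho (0 : 'rV[R]_q).
Proof. by move=> i; rewrite mxE normr0. Qed.

Lemma nscore_measurable i u : box rho u -> measurable_fun [set: R] (fun t => Delta i t u).
Proof.
move=> bu; apply: measurable_funM => //.
exact: (partial_measurable Theta_open g_cont g_diff i (in_Theta bu)).
Qed.

Let h_measurable u : box rho u -> measurable_fun [set: R] (fun t => h g theta T t u).
Proof. by move=> bu; exact: (regression_measurable g_cont (in_Theta bu)). Qed.

Let nscore_diff0 i t v : t \in `[0, T] -> box rho v -> `|Delta i t v - Delta i t 0| <= C * rho / T.
Proof.
move=> tT bv; have [_ h _] := bounds tT bv box0; apply: h => l.
by rewrite mxE subr0; exact: bv.
Qed.

Lemma increment_weightP i v : box rho v -> weight T (increment_weight i v).
Proof.
move=> bv; split.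
  apply/(measurable_restrictT _ _).1; first exact: measurable_itv.
  apply: measurable_funTS; apply: measurable_funM => //.
  by apply: measurable_funB; exact: nscore_measurable.
move=> t; rewrite /increment_weight patchE indicE; case: ifPn => [tI|_]; last first.
  by rewrite normr0 mulr0.
have tT : t \in `[0, T] by move: tI; rewrite inE.
rewrite mulr1 normrM normfV (gtr0_norm c1) ler_pdivrMr//.
rewrite (le_trans (nscore_diff0 i tT bv))// mulrC ler_wpM2l ?invr_ge0 ?(ltW T_gt0)//.
by rewrite lerDl.
Qed.

Variable eps : R -> R.
Hypothesis eps_int : lam.-integrable I (EFin \o eps).

Let mI : measurable I. Proof. exact: measurable_itv. Qed.

Let bounded_int (k : R -> R) (M : R) : measurable_fun [set: R] k ->
  (forall t, t \in `[0, T] -> `|k t| <= M) -> lam.-integrable I (EFin \o k).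
Proof.
move=> mk kM; apply: measurable_bounded_integrable => //.
- by rewrite /= lebesgue_measure_itv/=; case: ifP => _; rewrite -?EFinD ltry.
- exact: measurable_funTS.
- exists M; split; first exact: num_real.
  by move=> y My t tI /=; rewrite (le_trans (kM t _))// ltW.
Qed.

Let noise_int (k : R -> R) (M : R) : measurable_fun [set: R] k ->
  (forall t, t \in `[0, T] -> `|k t| <= M) -> lam.-integrable I (fun t => (eps t * k t)%:E).
Proof.
move=> mk kM.
apply: (@integrableMl _ _ _ lam I mI (EFin \o eps) k) => //; first exact: measurable_funTS.
exists M; split; first exact: num_real.
by move=> y My t tI /=; rewrite (le_trans (kM t _))// ltW.
Qed.

Let Rint_le (k : R -> R) (M : R) : measurable_fun [set: R] k -> 0 <= M ->
  (forall t, t \in `[0, T] -> `|k t| <= M) -> `|\int[lam]_(t in I) k t| <= M * T.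
Proof.
move=> mk M0 kM; have ik := bounded_int mk kM.
rewrite (le_trans (le_normr_Rintegral _ ik))//.
apply: (@le_trans _ _ (\int[lam]_(t in I) M)).
  apply: le_Rintegral => //; first exact: integrable_norm.
    by apply: (@bounded_int (cst M) M) => // t _; rewrite ger0_norm.
rewrite Rintegral_cst//= lebesgue_measure_itv/= lte_fin T_gt0 -EFinD /= subr0//.
Qed.

Let SumD t (u : 'rV[R]_q) := \sum_l Delta l t 0 * u 0 l.

Let SumD_le t u : t \in `[0, T] -> box rho u -> `|SumD t u| <= q%:R * (C / Num.sqrt T * rho).
Proof.
move=> tT bu; apply: (le_trans (ler_norm_sum _ _ _)).
apply: (@le_trans _ _ (\sum_(l < q) C / Num.sqrt T * rho)).
  apply: ler_sum => l _; rewrite normrM; apply: ler_pM => //.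
  by have [h _ _] := bounds tT box0 box0; exact: h.
by rewrite sumr_const card_ord mulr_natl.
Qed.

(** The difference splits into three integrals: of the noise against the
    variation of the score between 0 and a fixed v, of the noise against the
    variation between v and u, which is O(eta / T), and of the deterministic
    remainder rem, which is O(T^(-3/2)) pointwise. *)
Lemma psi_Lin_le i u v eta : box rho u -> box rho v ->
  (forall l, `|u 0 l - v 0 l| <= eta) ->
  `|(psi g theta eps T u - Lin g theta eps T u) 0 i| <=
  (C * rho + 1) * `|\int[lam]_t (eps t * increment_weight i v t)| +
  C * eta * ((\int[lam]_(t in I) `|eps t|) / T) +
  C ^+ 2 * (1 + q%:R * rho ^+ 2) / Num.sqrt T.
Proof.
move=> bu bv uv.
have s0 : 0 < Num.sqrt T by rewrite sqrtr_gt0.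
have mD := nscore_measurable.
have Db j w : box rho w -> forall t, t \in `[0, T] -> `|Delta j t w| <= C / Num.sqrt T.
  by move=> bw t tT; have [h _ _] := bounds tT bw bw; exact: h.
have mSum : measurable_fun [set: R] (fun t => SumD t u).
  by apply: measurable_sum => l; apply: measurable_funM => //; exact: mD.
pose rem t := (h g theta T t 0 - h g theta T t u) * Delta i t u + SumD t u * Delta i t 0.
have mrem : measurable_fun [set: R] rem.
  apply: measurable_funD; apply: measurable_funM => //; try exact: mD.
  by apply: measurable_funB; exact: h_measurable.
pose M := C ^+ 2 * (1 + q%:R * rho ^+ 2) / Num.sqrt T / T.
have M0 : 0 <= M.
  by rewrite /M !divr_ge0 ?(ltW s0) ?(ltW T_gt0)// mulr_ge0 ?sqr_ge0// addr_ge0// mulr_ge0// sqr_ge0.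
have rem_le t : t \in `[0, T] -> `|rem t| <= M.
  move=> tT; have [_ _ hle] := bounds tT bu box0.
  have -> : rem t = (h g theta T t 0 - h g theta T t u + SumD t u) * Delta i t u
      - SumD t u * (Delta i t u - Delta i t 0) by rewrite /rem; ring.
  rewrite (le_trans (ler_normB _ _))// !normrM.
  have -> : M = C / T * (C / Num.sqrt T) + q%:R * (C / Num.sqrt T * rho) * (C * rho / T).
    by rewrite /M; ring.
  apply: lerD; apply: ler_pM => //.
  - by rewrite -normrM; exact: (Db i u bu t tT).
  - exact: (SumD_le tT bu).
  - exact: (nscore_diff0 i tT bu).
have irem := bounded_int mrem rem_le.
have iSD : lam.-integrable I (EFin \o (fun t => SumD t u * Delta i t 0)).
  apply: (@bounded_int _ (q%:R * (C / Num.sqrt T * rho) * (C / Num.sqrt T))).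
    by apply: measurable_funM => //; exact: mD.
  by move=> t tT; rewrite normrM ler_pM// ?SumD_le// Db.
have ieu w : box rho w -> lam.-integrable I (fun t => (eps t * Delta i t w)%:E).
  by move=> bw; exact: (noise_int (mD i w bw) (Db i w bw)).
have ihD : lam.-integrable I (EFin \o (fun t => (h g theta T t 0 - h g theta T t u) * Delta i t u)).
  have -> : EFin \o (fun t => (h g theta T t 0 - h g theta T t u) * Delta i t u) =
    (fun t => (rem t)%:E - (SumD t u * Delta i t 0)%:E)%E.
    by apply/funext => t /=; rewrite -EFinB /rem addrK.
  exact: integrableB.
have Dv0 : `|\int[lam]_(t in I) (eps t * (Delta i t v - Delta i t 0))| =
    (C * rho + 1) * `|\int[lam]_t (eps t * increment_weight i v t)|.
  have -> : \int[lam]_t (eps t * increment_weight i v t) =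
      \int[lam]_(t in I) ((C * rho + 1)^-1 * (eps t * (Delta i t v - Delta i t 0))).
    rewrite [RHS]Rintegral_mkcond; apply: eq_Rintegral => t _.
    rewrite /increment_weight !patchE; case: ifP => _; last by rewrite mulr0.
    by rewrite mulrA mulrC.
  rewrite RintegralZl//; last first.
    have -> : EFin \o (fun t => eps t * (Delta i t v - Delta i t 0)) =
      (fun t => (eps t * Delta i t v)%:E - (eps t * Delta i t 0)%:E)%E.
      by apply/funext => t /=; rewrite -EFinB mulrBr.
    by apply: integrableB => //; exact: ieu.
  by rewrite normrM (gtr0_norm (_ : 0 < (C * rho + 1)^-1)) ?invr_gt0// mulVKf// gt_eqF.
have Duv_le t : t \in `[0, T] -> `|Delta i t u - Delta i t v| <= C * eta / T.
  by move=> tT; have [_ hd _] := bounds tT bu bv; exact: hd.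
have iuv : lam.-integrable I (fun t => (eps t * (Delta i t u - Delta i t v))%:E).
  apply: (noise_int _ Duv_le); apply: measurable_funB; exact: mD.
have iv0 : lam.-integrable I (fun t => (eps t * (Delta i t v - Delta i t 0))%:E).
  apply: (noise_int (M := C * rho / T)).
    by apply: measurable_funB; exact: mD.
  by move=> t tT; exact: nscore_diff0.
have -> : (psi g theta eps T u - Lin g theta eps T u) 0 i =
   \int[lam]_(t in I) (eps t * (Delta i t v - Delta i t 0)) +
   \int[lam]_(t in I) (eps t * (Delta i t u - Delta i t v)) + \int[lam]_(t in I) rem t.
  rewrite !mxE -/(Delta _ _ _).
  have -> : \int[lam]_(t in I) ((eps t - \sum_(l < q) g1 g l t theta / d1 g theta T l * u 0 l)
      * (g1 g i t theta / d1 g theta T i)) =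
      \int[lam]_(t in I) (eps t * Delta i t 0 - SumD t u * Delta i t 0).
    apply: eq_Rintegral => t _; rewrite /SumD /nscore /h1 local_param0 mulrBl; congr (_ - _ * _).
  rewrite RintegralB//; last exact: ieu.
  have -> : \int[lam]_(t in I) rem t =
     \int[lam]_(t in I) ((h g theta T t 0 - h g theta T t u) * Delta i t u) +
     \int[lam]_(t in I) (SumD t u * Delta i t 0) by rewrite -RintegralD.
  have -> : \int[lam]_(t in I) (eps t * (Delta i t v - Delta i t 0)) +
   \int[lam]_(t in I) (eps t * (Delta i t u - Delta i t v)) =
    \int[lam]_(t in I) (eps t * Delta i t u) - \int[lam]_(t in I) (eps t * Delta i t 0).
    rewrite -RintegralD// -RintegralB//; [|exact: ieu..].
    by apply: eq_Rintegral => t _; ring.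
  by rewrite opprB [X in _ + X = _]addrC addrACA.
rewrite (le_trans (ler_normD _ _))// lerD//.
  rewrite (le_trans (ler_normD _ _))// lerD//; first by rewrite Dv0.
  rewrite (le_trans (le_normr_Rintegral _ iuv))//.
  have ie := integrable_norm eps_int.
  apply: (@le_trans _ _ (\int[lam]_(t in I) (C * eta / T * `|eps t|))).
    apply: le_Rintegral => //; first exact: (integrable_norm iuv).
      have -> : EFin \o (fun t => C * eta / T * `|eps t|) =
        (fun t => (C * eta / T)%:E * (`|eps t|)%:E)%E by apply/funext => t.
      exact: integrableZl.
    by move=> t tI; rewrite normrM mulrC ler_wpM2r// Duv_le.
  rewrite RintegralZl// le_eqVlt; apply/orP; left; apply/eqP.
  by rewrite [LHS]mulrAC -mulrA.
have -> : C ^+ 2 * (1 + q%:R * rho ^+ 2) / Num.sqrt T = M * T.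
  by rewrite /M divfK// gt_eqF.
exact: Rint_le.
Qed.

End path_bound.

(** * Convergence in probability *)

Theorem theorem2 (R : realType) (disp : measure_display)
  (Omega : measurableType disp) (P : probability Omega R)
  (* the Gaussian process *)
  (xi : R -> Omega -> R)
  (xi_meas : measurable_process xi)
  (xi_msc : ms_continuous P xi)
  (xi_stat : stationary P xi)
  (xi_gauss : gaussian_process P xi)
  (xi_mean : forall t, ('E_P[xi t] = 0)%E)
  (xi_var : forall t, 'E_P[fun w => (xi t w ^+ 2)%R]%E = 1%E)
  (kappa : nat) (D vark alpha : 'I_kappa.+1 -> R)
  (D_ge0 : forall j, 0 <= D j)
  (D_sum : \sum_(j < kappa.+1) D j = 1)
  (vark_ge0 : 0 <= vark ord0)
  (vark_incr : forall j k : 'I_kappa.+1, (j < k)%N -> vark j < vark k)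
  (alpha_gt0 : forall j, 0 < alpha j)
  (xi_cov : forall t, 'E_P[fun w => (xi 0 w * xi t w)%R]%E =
     (\sum_(j < kappa.+1)
        D j * (cos (vark j * t) / (1 + t ^+ 2) `^ (alpha j / 2)))%:E)
  (* the noise eps(t) = G(xi(t)) *)
  (G : R -> R) (m : nat)
  (G_meas : measurable_fun [set: R] G)
  (G_mean : 'E_P[fun w => G (xi 0%R w)]%E = 0%E)
  (G_4 : ('E_P[fun w => (G (xi 0 w) ^+ 4)%R] < +oo)%E)
  (m_ge1 : (1 <= m)%N)
  (G_rank : hermite_rank G m)
  (* the regression function *)
  (q : nat) (Theta : set 'rV[R]_q) (Theta_open : open Theta)
  (theta : 'rV[R]_q) (theta_in : Theta theta)
  (g : R -> 'rV[R]_q -> R)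
  (g_cont : {within [set: R] `*` closure Theta,
               continuous (fun p : R * 'rV[R]_q => g p.1 p.2)})
  (g_diff : forall t, twice_differentiable_on (closure Theta) (g t))
  (d_liminf : forall i : 'I_q,
     (0 < limf_einf (fun T : R => (T^-1 * d1 g theta T i ^+ 2)%:E)
            (pinfty_nbhs R))%E)
  (h_bound : forall r : R, 0 <= r ->
     exists (k1 : 'I_q -> R) (k2 k3 : 'I_q -> 'I_q -> R),
     [/\ forall i, 0 < k1 i, forall i l, 0 < k2 i l, forall i l, 0 < k3 i l &
     \forall T \near +oo, forall i l : 'I_q,
     [/\ forall t u, t \in `[0, T] -> eball r u ->
           `|h1 g theta T i t u| <= k1 i / Num.sqrt T * d1 g theta T i,
         forall t u, t \in `[0, T] -> eball r u ->
           `|h2 g theta T i l t u| <= k2 i l / Num.sqrt T * d2 g theta T i l &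
         d2 g theta T i l
           <= k3 i l / Num.sqrt T * (d1 g theta T i * d1 g theta T l)]]) :
  (* the probability is the outer one, mu_ext P; it is P on measurable sets *)
  forall rho r : R, 0 < rho -> 0 < r ->
    mu_ext P [set w | (r%:E < ereal_sup
       [set (enorm (psi g theta (fun t => G (xi t w)) T u
                    - Lin g theta (fun t => G (xi t w)) T u))%:E
       | u in eball rho])%E] @[T --> +oo] --> 0%E.
Proof.
move=> rho r rho_gt0 r_gt0.
have rho_ge0 := ltW rho_gt0.
pose B t := \sum_(j < kappa.+1) D j * (cos (vark j * t) / (1 + t ^+ 2) `^ (alpha j / 2)).
have B0 := covariance_decay vark D_ge0 D_sum alpha_gt0.
pose nu := marginal_law P xi_meas.
have nuE t (A : set R) : measurable A -> P (xi t @^-1` A) = nu A.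
  exact: (marginal_lawE xi_meas xi_stat).
have mGx t : measurable_fun setT (fun w => G (xi t w)) := section_measurable xi_meas t G_meas.
have mEG : measurable_fun [set: R] (EFin \o G) by apply/measurable_EFinP.
have G1 : (\int[nu]_x `|G x|%:E < +oo)%E.
  rewrite -(integral_law xi_meas nuE 0 (h := fun x => `|G x|%:E))//; last first.
    by apply/measurable_EFinP; apply: measurableT_comp.
  have mG4 : measurable_fun setT (fun w => (G (xi 0 w) ^+ 4)%:E).
    by apply/measurable_EFinP; exact: measurable_funX.
  have G40 w : (0 <= (G (xi 0 w) ^+ 4)%:E)%E by rewrite lee_fin exprn_even_ge0.
  apply: (@le_lt_trans _ _ (\int[P]_w (1 + (G (xi 0 w) ^+ 4)%:E))%E).
    apply: ge0_le_integral => //.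
    - by apply/measurable_EFinP; apply: measurableT_comp.
    - exact: emeasurable_funD.
    - move=> w _; rewrite -EFinD lee_fin.
      rewrite -[G _ ^+ 4](ger0_norm (_ : 0 <= _)) ?exprn_even_ge0// normrX.
      have := normr_ge0 (G (xi 0 w)); move: `|G (xi 0 w)| => y y0.
      have := sqr_ge0 (y - 2^-1); have := sqr_ge0 (y ^+ 2 - 2^-1).
      rewrite (_ : y ^+ 4 = y ^+ 2 ^+ 2) ?exprM//; nra.
  rewrite ge0_integralD// integral_cst//= probability_setT mule1.
  by rewrite lte_add_pinfty ?ltry//; move: G_4; rewrite expectation.unlock.
have intG : nu.-integrable setT (EFin \o G) by apply/integrableP.
have meanG : \int[nu]_x G x = 0.
  have mX : measurable_fun setT (xi 0 : Omega -> measurableTypeR R).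
    exact: (section_measurable xi_meas 0 (@measurable_id _ _ setT)).
  pose X : {mfun Omega >-> measurableTypeR R} :=
    HB.pack (xi 0 : Omega -> measurableTypeR R) (isMeasurableFun.Build _ _ _ _ _ mX).
  have iGP : P.-integrable setT (fun w => (G (xi 0 w))%:E).
    apply/integrableP; split; first by apply/measurable_EFinP.
    rewrite (integral_law xi_meas nuE 0 (h := fun x => `|G x|%:E))//.
    by apply/measurable_EFinP; apply: measurableT_comp.
  transitivity (\int[P]_w G (xi 0 w)); last first.
    by move: G_mean; rewrite expectation.unlock /Rintegral => ->.
  rewrite /Rintegral -(integral_distribution (X := X) mEG iGP).
  by congr fine; apply: eq_measure_integral => A mA _; rewrite -(nuE 0).
have erg : ergodic P xi nu G.
  exact: (gaussian_ergodic (B := B) xi_stat xi_gauss xi_mean xi_var xi_cov B0 intG).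
have [C C_gt0 Hb] := near_nscore_bounds Theta_open theta_in g_diff d_liminf h_bound rho_ge0.
have near_in := near_local_param Theta_open theta_in d_liminf rho.
pose M := fine (\int[nu]_x `|G x|%:E)%E.
have M_ge0 : 0 <= M by rewrite fine_ge0// integral_ge0.
have GM : (\int[nu]_x `|G x|%:E <= M%:E)%E.
  by rewrite fineK// ge0_fin_numE// integral_ge0.
pose bad T := [set w | (r%:E < ereal_sup
       [set (enorm (psi g theta (fun t => G (xi t w)) T u
                    - Lin g theta (fun t => G (xi t w)) T u))%:E
       | u in eball rho])%E].
have key (e : R) : 0 < e -> \forall T \near +oo, (mu_ext P (bad T) <= e%:E)%E.
  move=> e_gt0.
  pose q1 : R := q.+1%:R.
  have q1_gt0 : 0 < q1 by rewrite ltr0n.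
  have M1_gt0 : 0 < M + 1 by rewrite ltr_wpDl.
  (* eta, e1 and T make each of the three terms of the bound at most r e / 3 *)
  pose eta := r * e / (3 * q1 * C * (M + 1)).
  have eta_gt0 : 0 < eta by rewrite divr_gt0 ?mulr_gt0.
  have [s [sbox net]] := box_net q rho_ge0 eta_gt0.
  pose C1 := C * rho + 1.
  have C1_gt0 : 0 < C1 by rewrite ltr_wpDl// mulr_ge0// ltW.
  pose J : R := (size s)%:R.
  have qJ_gt0 : 0 < q%:R * J + 1 by rewrite ltr_wpDl// mulr_ge0.
  pose e1 := r * e / (3 * ((q%:R * J + 1) * C1)).
  have e1_gt0 : 0 < e1 by rewrite divr_gt0 ?mulr_gt0.
  pose C3 := C ^+ 2 * (1 + q%:R * rho ^+ 2).
  have C3_ge0 : 0 <= C3 by rewrite mulr_ge0 ?sqr_ge0// addr_ge0// mulr_ge0// sqr_ge0.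
  near=> T.
  have T_gt0 : 0 < T by near: T; exact: nbhs_pinfty_gt.
  have sT_gt0 : 0 < Num.sqrt T by rewrite sqrtr_gt0.
  have sT : q1 * C3 * 3 / (r * e) <= Num.sqrt T by near: T; exact: near_le_sqrt.
  have ergT : forall phi, weight T phi -> outer_mean_le P
      (fun w => \int[lebesgue_measure]_t ((G (xi t w) - \int[nu]_x G x) * phi t)) e1.
    by near: T; exact: erg.
  have inT : forall u, box rho u -> Theta (local_param g theta T u) by near: T.
  have bounds : forall t (u v : 'rV[R]_q), t \in `[0, T] -> box rho u -> box rho v ->
    [/\ forall i, `|nscore g theta T i t u| <= C / Num.sqrt T,
      forall i eta, (forall l, `|u 0 l - v 0 l| <= eta) ->
        `|nscore g theta T i t u - nscore g theta T i t v| <= C * eta / T &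
      `|h g theta T t 0 - h g theta T t u + \sum_l nscore g theta T l t 0 * u 0 l| <= C / T].
    by near: T.
  pose W i v := increment_weight g theta rho C T i v.
  have wW i v : box rho v -> weight T (W i v).
    exact: (increment_weightP Theta_open g_cont g_diff rho_ge0 (ltW C_gt0) T_gt0 inT bounds).
  pose Z i v w := \int[lebesgue_measure]_t (G (xi t w) * W i v t).
  have outZ i v : v \in s -> outer_mean_le P (Z i v) e1.
    move=> /sbox/(wW i)/ergT; rewrite meanG.
    by rewrite /Z; under eq_fun do under eq_Rintegral do rewrite subr0.
  pose A w := \sum_(i <- enum 'I_q) `|\sum_(v <- s) `|Z i v w| |.
  have outA : outer_mean_le P A (q%:R * (J * e1)).
    rewrite -{1}(size_enum_ord q); apply: outer_mean_le_sum => i _.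
    by apply: outer_mean_le_sum => v vs; exact: outZ.
  (* time average of the absolute noise; its value on the negligible set of
     non-integrable paths only has to exceed the threshold *)
  pose I : set R := `[0, T]%classic.
  pose K := r / (q1 * C * eta).
  have qCe_gt0 : 0 < q1 * C * eta by apply: mulr_gt0 => //; exact: mulr_gt0.
  have K_gt0 : 0 < K by exact: divr_gt0.
  pose path w := lebesgue_measure.-integrable I (fun t => (G (xi t w))%:E).
  pose N w := if `[< path w >] then (\int[lebesgue_measure]_(t in I) `|G (xi t w)|) / T else K.
  have outN : outer_mean_le P N M.
    have mI : measurable I by exact: measurable_itv.
    pose phi0 (t : R) : R := T^-1 * \1_I t.
    have w0 : weight T phi0.
      split=> [|t]; first by apply: measurable_funM => //; exact: measurable_indic.
      by rewrite ger0_norm// mulr_ge0// invr_ge0 ltW.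
    have mG' : measurable_fun [set: R] (fun x => `|G x|) by apply: measurableT_comp.
    have [mY EY] := integral_path_weight_le xi_meas nuE mG' (fun x => normr_ge0 (G x)) GM T_gt0 w0.
    exists (fun w => \int[lebesgue_measure]_t (`|G (xi t w)| * `|phi0 t|)%:E)%E; split => // w.
    have mpath : measurable_fun I (fun t => (G (xi t w))%:E).
      by apply: measurable_funTS; apply/measurable_EFinP; exact: (path_measurable xi_meas w G_meas).
    have -> : (\int[lebesgue_measure]_t (`|G (xi t w)| * `|phi0 t|)%:E =
        T^-1%:E * \int[lebesgue_measure]_(t in I) `|(G (xi t w))%:E|)%E.
      rewrite -ge0_integralZl//; last 2 first.
      - exact: measurableT_comp.
      - by rewrite lee_fin invr_ge0 ltW.
      rewrite [RHS]integral_mkcond; apply: eq_integral => t _.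
      rewrite patchE /phi0 indicE; case: ifP => _; last by rewrite mulr0 normr0 mulr0.
      have TV0 : 0 <= T^-1 by rewrite invr_ge0 ltW.
      by rewrite mulr1 (ger0_norm TV0) EFinM muleC.
    rewrite /N; case: asboolP => [iw|nw].
      rewrite ger0_norm; last first.
        by rewrite divr_ge0 ?(ltW T_gt0)//; apply: Rintegral_ge0.
      rewrite mulrC EFinM /Rintegral fineK//.
      exact: integrable_fin_num (integrable_abse iw).
    have -> : (\int[lebesgue_measure]_(t in I) `|(G (xi t w))%:E| = +oo)%E.
      apply/eqP; rewrite -leye_eq leNgt; apply/negP => fin; apply: nw.
      by apply/integrableP.
    by rewrite gt0_muley ?leey// lte_fin invr_gt0.
  pose Zt w := C1 * A w + (q1 * C * eta) * N w + q1 * (C3 / Num.sqrt T).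
  have A_ge0 w : 0 <= A w by apply: sumr_ge0.
  have N_ge0 w : 0 <= N w.
    rewrite /N; case: asboolP => _; last exact: ltW.
    by rewrite divr_ge0 ?(ltW T_gt0)//; apply: Rintegral_ge0.
  have last_ge0 : 0 <= q1 * (C3 / Num.sqrt T).
    by rewrite mulr_ge0 ?(ltW q1_gt0)// divr_ge0// ltW.
  have outZt : outer_mean_le P Zt
      (C1 * (q%:R * (J * e1)) + (q1 * C * eta) * M + q1 * (C3 / Num.sqrt T)).
    apply: (@outer_mean_leD _ _ _ P (fun w => C1 * A w + (q1 * C * eta) * N w)
      (cst (q1 * (C3 / Num.sqrt T)))) => [||w]; last exact: ler_normD.
      apply: (@outer_mean_leD _ _ _ P (fun w => C1 * A w) (fun w => (q1 * C * eta) * N w)) => [||w].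
      - by apply: (outer_mean_leZ (ltW C1_gt0) outA) => w; rewrite normrM (gtr0_norm C1_gt0).
      - by apply: (outer_mean_leZ (ltW qCe_gt0) outN) => w; rewrite normrM (gtr0_norm qCe_gt0).
      - exact: ler_normD.
    exact: outer_mean_le_cst.
  have total : C1 * (q%:R * (J * e1)) + (q1 * C * eta) * M + q1 * (C3 / Num.sqrt T) <= r * e.
    have re_gt0 : 0 < r * e by exact: mulr_gt0.
    have t1 : C1 * (q%:R * (J * e1)) <= r * e / 3.
      have -> : C1 * (q%:R * (J * e1)) = (q%:R * J) / (q%:R * J + 1) * (r * e / 3).
        by rewrite /e1; field; rewrite !gt_eqF.
      by rewrite ler_piMl ?divr_ge0 ?(ltW re_gt0)// ler_pdivrMr// mul1r lerDl.
    have t2 : (q1 * C * eta) * M <= r * e / 3.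
      have -> : (q1 * C * eta) * M = M / (M + 1) * (r * e / 3).
        by rewrite /eta; field; rewrite !gt_eqF.
      by rewrite ler_piMl ?divr_ge0 ?(ltW re_gt0)// ler_pdivrMr// mul1r lerDl.
    have t3 : q1 * (C3 / Num.sqrt T) <= r * e / 3.
      rewrite mulrA ler_pdivrMr//; move: sT; rewrite ler_pdivrMr// => sT'.
      by rewrite (_ : _ * Num.sqrt T = Num.sqrt T * (r * e) / 3) ?ler_pdivlMr//; ring.
    by rewrite (le_trans (lerD (lerD t1 t2) t3))//; lra.
  apply: le_trans (markov_outer r_gt0 outZt _) _; last first.
    by rewrite lee_fin ler_pdivrMl.
  move=> w /= badw; have Zt_ge0 : 0 <= Zt w.
    apply: addr_ge0 => //; apply: addr_ge0; apply: mulr_ge0 => //; exact: ltW.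
  rewrite ger0_norm//.
  have [iw|nw] := pselect (path w); last first.
    have qK : q1 * C * eta * K = r by rewrite /K mulrC divfK ?gt_eqF.
    rewrite /Zt /N; case: asboolP => // _; rewrite qK.
    by rewrite -addrA addrCA lerDl addr_ge0// mulr_ge0// ltW.
  have [_ [u bu <-]] := ereal_sup_gt badw; rewrite lte_fin => /ltW rle.
  have bxu := eball_box bu; have [v vs uv] := net u bxu.
  rewrite (le_trans rle)// (le_trans (enorm_le_sum _))//.
  apply: (@le_trans _ _ (\sum_(i < q) (C1 * (\sum_(v <- s) `|Z i v w|) +
      (C * eta * N w + C3 / Num.sqrt T)))).
    apply: ler_sum => i _.
    have := psi_Lin_le Theta_open g_cont g_diff rho_ge0 (ltW C_gt0) T_gt0 inT bounds iw i
      bxu (sbox v vs) uv.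
    move=> /le_trans; apply; rewrite -addrA; apply: lerD; last first.
      by rewrite /N; case: asboolP.
    rewrite ler_wpM2l ?(ltW C1_gt0)// (big_rem v vs)//= lerDl.
    by rewrite sumr_ge0.
  rewrite big_split/= sumr_const card_ord -mulr_sumr /Zt -addrA; apply: lerD.
    rewrite ler_wpM2l ?(ltW C1_gt0)// /A big_enum/=; apply: ler_sum => i _.
    by rewrite ler_norm.
  have cN_ge0 : 0 <= C * eta * N w + C3 / Num.sqrt T.
    apply: addr_ge0; last by apply: divr_ge0 => //; exact: ltW.
    by apply: mulr_ge0 => //; apply: mulr_ge0; exact: ltW.
  rewrite -[leLHS]mulr_natl (_ : q1 * C * eta * N w + _ = q1 * (C * eta * N w + C3 / Num.sqrt T)).
    by rewrite ler_wpM2r// ler_nat.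
  by rewrite mulrDr !mulrA.
apply/fine_cvgP; split.
  apply: filterS (key 1 ltr01) => T le1.
  rewrite ge0_fin_numE; first by rewrite (le_lt_trans le1)// ltry.
  exact: mu_ext_ge0.
apply/cvgr0Pnorm_le => e e_gt0; apply: filterS (key e e_gt0) => T leT.
have m0 : (0 <= mu_ext P (bad T))%E by exact: mu_ext_ge0.
rewrite /= ger0_norm ?fine_ge0// -lee_fin fineK//.
by rewrite ge0_fin_numE// (le_lt_trans leT)// ltry.
Unshelve. all: by end_near. Qed.
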